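(* Let $N$ be a feed-forward network with layers $C_0,\dots,C_m$, $f\in\mathcal{V}_0(N)$ generic, $L$ a feed-forward lift of $N$ and $1<j\le m-1$. Denote by $C'_j$ the $(j+1)$-th layer of $L$ and by $(\sigma^L_i)_{i=1}^k$ the functions representing $L$. Assume that $L$ is the split of a cell $c\in C_j$ into two cells $c_1,c_2\in C'_j$ (and so a lift inside $C_j$). Suppose there exist $d',d''\in C_{j+1}$ such that $\sigma^L_i(d'),\sigma^L_i(d'')\in\{c_1,c_2\}$ for every $1\le i\le k$, and $$w_1^{d'}w_1^{d''}<0,\qquad w_2^{d'}w_2^{d''}<0,\qquad w_1^{d'}w_1^{d''}+w_2^{d'}w_2^{d''}<w_1^{d'}w_2^{d''}+w_1^{d''}w_2^{d'},$$ where, for $d\in C_{j+1}$, $$w_1^d=\sum_{i:\,\sigma_i^L(d)=c_1} f_i,\qquad w_2^d=\sum_{i:\,\sigma_i^L(d)=c_2} f_i .$$ Then every bifurcation branch $b$ of $f$ on $L$ is lifted from $N$.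
   Context: A network $N$ with $k$ edge types is a finite set of cells $C$ together with functions $\sigma_1,\dots,\sigma_k:C\to C$ ($\sigma_i(c)$ is the source of the unique edge of type $i$ targeting $c$); $|N|=|C|$. Networks represented by $(\sigma_i:C\to C)$ and $(\sigma_i':C'\to C')$ are equal if there is a bijection $\varphi:C\to C'$ with $\varphi\circ\sigma_i=\sigma_i'\circ\varphi$ for all $i$. A feed-forward network is a network whose cells can be partitioned into nonempty layers $C_0,\dots,C_m$ such that $\sigma_i(c)=c$ for $c\in C_0$ and all $i$; $\sigma_i(C_j)\subseteq C_{j-1}$ for $1\le j\le m$ and all $i$; and for $0\le j\le m-1$ every $c\in C_j$ equals $\sigma_i(c')$ for some $c'\in C_{j+1}$ and some $i$. Feed-forward networks are assumed connected (as undirected graphs). A coloring is an equivalence relation $\bowtie$ on the cells; it is balanced if $c\bowtie c'$ implies $\sigma_i(c)\bowtie\sigma_i(c')$ for all $i$. The quotient network $N/\bowtie$ has the $\bowtie$-classes as cells and is represented by $\sigma_i^{\bowtie}([c]_{\bowtie})=[\sigma_i(c)]_{\bowtie}$. $L$ is a lift of $N$ if $N=L/\bowtie$ for some balanced coloring $\bowtie$ in $L$. $L$ is the split of a cell $c$ of $N$ into cells $c_1,\dots,c_l$ of $L$ if the coloring $\bowtie$ of $L$ whose only non-singleton class is $\{c_1,\dots,c_l\}$ is balanced, $L/\bowtie=N$ and $[c_i]_{\bowtie}=c$. For a feed-forward lift $L$ (layers $C'_0,\dots,C'_n$) of $N$ (layers $C_0,\dots,C_m$), $L$ is a lift inside $C_j$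 if $m=n$, $|C'_j|\ne|C_j|$ and $|C'_i|=|C_i|$ for $i\ne j$. In the claim, the cells of $L$ other than $c_1,c_2$ are identified with the cells of $N$ other than $c$; in particular the layer $C'_{j+1}$ of $L$ is identified with $C_{j+1}$. $\mathcal{V}(N)$ is the set of smooth $f:\mathbb{R}\times\mathbb{R}^k\times\mathbb{R}\to\mathbb{R}$, $(x_0,x_1,\dots,x_k,\lambda)\mapsto f$, with $f(0,\dots,0,\lambda)=0$ for all $\lambda$; $f_i=\partial f/\partial x_i$ at the origin. $\mathcal{V}_0(N)=\{f\in\mathcal{V}(N): f_0=0\}$. It depends only on $k$, so $\mathcal{V}_0(N)=\mathcal{V}_0(L)$. The vector field is $(f^N(x,\lambda))_c=f(x_c,x_{\sigma_1(c)},\dots,x_{\sigma_k(c)},\lambda)$ on $\mathbb{R}^{|N|}$. ''Generic'' means: there is an open dense subset $O$ of the space of possible values of the first and second order partial derivatives at the origin of elements of the class, such that the statement holds for every $f$ in the class whose derivatives lie in $O$. A domain is an interval $]-\lambda_0,0]$, $]-\lambda_0,\lambda_0[$ or $[0,\lambda_0[$ with $\lambda_0>0$. An equilibrium branch of $f$ on $N$ is a function $b:D\to\mathbb{R}^{|N|}$ on a domain $D$ with $b(0)=0$ and $f^N(b(\lambda),\lambda)=0$ for all $\lambda\in D$, which is smooth if $D=]-\lambda_0,\lambda_0[$, and continuous on $D$ and smooth on $D\setminus\{0\}$ if $D$ is one-sided. Branches are taken as germs: $b_1:D_1\to\mathbb{R}^{|N|}$ and $b_2:D_2\to\mathbb{R}^{|N|}$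 are related if there is an open neighborhood $U$ of $0$ with $U\cap D_1\cap D_2\ne\{0\}$ and $b_1=b_2$ on $U\cap D_1\cap D_2$; germ equivalence is the transitive closure, and equivalent branches are identified. The bifurcation branches are the equilibrium branches different from the trivial branch $0$. A bifurcation branch $b$ of $f$ on $L$ is lifted from $N$ if there is a balanced coloring $\bowtie$ in $L$ with $N=L/\bowtie$ and $b\in\Delta_{\bowtie}$, i.e. $b(\lambda)\in\Delta_{\bowtie}=\{x: c\bowtie d\Rightarrow x_c=x_d\}$ for all $\lambda$ in the domain near $0$. *)

(* Defs.v *)
From HB Require Import structures.
From Stdlib Require Import Relation_Operators.
From mathcomp Require Import all_boot all_order all_algebra generic_quotient.
From mathcomp Require Import all_classical all_reals all_analysis.

Set Implicit Arguments.
Unset Strict Implicit.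
Unset Printing Implicit Defensive.
Import Order.TTheory GRing.Theory Num.Theory.
Import numFieldNormedType.Exports.
Local Open Scope classical_set_scope.
Local Open Scope ring_scope.
Local Open Scope quotient_scope.

Section FiniteQuotient.
Variables (D : Type) (C : finType) (CD : C -> D) (DC : D -> C).
Variables (eD : equiv_rel D) (encD : encModRel CD DC eD).

HB.instance Definition _ :=
  Finite.copy {eq_quot encD} (can_type EquivQuot.ereprK).

End FiniteQuotient.

Section Networks.
Variable k : nat.

Record network := Network {
  cell :> finType;
  src : 'I_k -> cell -> cell
}.

Definition network_iso (N N' : network) (phi : N -> N') : Prop :=
  bijective phi /\ forall i c, phi (src i c) = src i (phi c).

Definition network_eq (N N' : network) : Prop :=
  exists phi : N -> N', network_iso phi.

Definition balanced (N : network) (e : equiv_rel N) : Prop :=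
  forall c d, e c d -> forall i, e (src i c) (src i d).

(* The sources in the quotient are computed on chosen representatives; by
   [quotient_srcE] the choice is irrelevant when the coloring is balanced. *)
Definition quotient_network (N : network) (e : equiv_rel N) : network :=
  @Network {eq_quot e} (fun i q => \pi_{eq_quot e} (src i (repr q))).

Definition class_of (N : network) (e : equiv_rel N) (c : N) :
    quotient_network e :=
  \pi_{eq_quot e} c.

Lemma class_ofP (N : network) (e : equiv_rel N) (c d : N) :
  reflect (class_of e c = class_of e d) (e c d).
Proof. exact: eqmodP. Qed.

Lemma quotient_srcE (N : network) (e : equiv_rel N) (i : 'I_k) (c : N) :
  balanced e -> src i (class_of e c) = class_of e (src i c).
Proof.
move=> be; apply/class_ofP/be; apply/class_ofP.
by rewrite /class_of /= reprK.
Qed.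

Definition lift_of (L N : network) : Prop :=
  exists2 e : equiv_rel L, balanced e & network_eq (quotient_network e) N.

Definition adjacent (N : network) : rel N :=
  fun c d => [exists i, (src i c == d) || (src i d == c)].

Definition connected_network (N : network) : Prop :=
  forall c d : N, connect (@adjacent N) c d.

(* [lay c] is the index of the layer containing [c], so that the layer C_j is
   the fiber of [lay] over j, for 0 <= j <= m. *)
Record feed_forward (N : network) (m : nat) (lay : N -> nat) : Prop := {
  ff_connected : connected_network N;
  ff_bound : forall c, (lay c <= m)%N;
  ff_nonempty : forall j, (j <= m)%N -> exists c, lay c = j;
  ff_first : forall c i, lay c = 0%N -> src i c = c;
  ff_src : forall c i, (0 < lay c)%N -> (lay (src i c)).+1 = lay c;
  ff_target : forall c, (lay c < m)%N ->
    exists c' i, lay c' = (lay c).+1 /\ src i c' = c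
}.

Section Collapse.
Variables (L : network) (A : {set L}).

Definition collapse_rel : rel L :=
  fun c d => (c == d) || (c \in A) && (d \in A).

Fact collapse_refl : reflexive collapse_rel.
Proof. by move=> c; rewrite /collapse_rel eqxx. Qed.

Fact collapse_sym : symmetric collapse_rel.
Proof. by move=> c d; rewrite /collapse_rel eq_sym andbC. Qed.

Fact collapse_trans : transitive collapse_rel.
Proof.
move=> d c e /orP[/eqP-> //|/andP[cA dA]] /orP[/eqP<-|/andP[_ eA]].
  by rewrite /collapse_rel cA dA orbT.
by rewrite /collapse_rel cA eA orbT.
Qed.

Definition collapse : equiv_rel L :=
  EquivRel collapse_rel collapse_refl collapse_sym collapse_trans.

End Collapse.

(* [L] is the split of the cell [c] of [N] into the cells in [A], where [phi]
   is the bijection identifying the quotient with [N]. *)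
Definition split_of (L N : network) (A : {set L}) (c : N)
    (phi : quotient_network (collapse A) -> N) : Prop :=
  [/\ (1 < #|A|)%N, balanced (collapse A), network_iso phi &
      forall d, d \in A -> phi (class_of (collapse A) d) = c].

End Networks.

Section Smooth.
Variables (R : realType) (n : nat).
Implicit Types f : 'rV[R]_n -> R.

Definition pderiv (i : 'I_n) f : 'rV[R]_n -> R :=
  fun x => 'D_(delta_mx 0 i) f x.

Definition iter_pderiv (s : seq 'I_n) f : 'rV[R]_n -> R := foldr pderiv f s.

Definition smooth f : Prop :=
  forall s : seq 'I_n, continuous (iter_pderiv s f) /\
    forall i x, derivable (iter_pderiv s f) x (delta_mx 0 i).

Definition jet2 f : 'rV[R]_n * 'M[R]_n :=
  (\row_i pderiv i f 0, \matrix_(i, j) pderiv i (pderiv j f) 0).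

(* [O] is open and dense in [J] for the subspace topology. *)
Definition open_dense_in (T : topologicalType) (J O : set T) : Prop :=
  (exists2 V : set T, open V & O = J `&` V) /\ J `<=` closure O.

Definition generically (F : set ('rV[R]_n -> R))
    (P : ('rV[R]_n -> R) -> Prop) : Prop :=
  exists2 O : set ('rV[R]_n * 'M[R]_n), open_dense_in (jet2 @` F) O &
    forall f, F f -> O (jet2 f) -> P f.

End Smooth.

Section VectorFields.
Variables (R : realType) (k : nat).

(* R x R^k x R is encoded as the row vectors of size 1 + k + 1. *)
Definition arg_point (x0 : R) (x : 'rV[R]_k) (l : R) : 'rV[R]_(1 + k + 1) :=
  row_mx (row_mx x0%:M x) l%:M.

Definition ix_self : 'I_(1 + k + 1) := lshift 1 (lshift k ord0).
Definition ix_edge (i : 'I_k) : 'I_(1 + k + 1) := lshift 1 (rshift 1 i).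

Definition VN : set ('rV[R]_(1 + k + 1) -> R) :=
  [set f | smooth f /\ forall l, f (arg_point 0 0 l) = 0].

Definition f_self (f : 'rV[R]_(1 + k + 1) -> R) : R := pderiv ix_self f 0.
Definition f_edge (f : 'rV[R]_(1 + k + 1) -> R) (i : 'I_k) : R :=
  pderiv (ix_edge i) f 0.

Definition VN0 : set ('rV[R]_(1 + k + 1) -> R) :=
  [set f | VN f /\ f_self f = 0].

Variables (N : network k) (f : 'rV[R]_(1 + k + 1) -> R).

Definition vector_field (x : {ffun N -> R}) (l : R) : {ffun N -> R} :=
  [ffun c => f (arg_point (x c) (\row_i x (src i c)) l)].

Definition weight (a d : N) : R := \sum_(i < k | src i d == a) f_edge f i.

(* A function on [dom]; the values of [val_of] outside [dom] are irrelevant. *)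
Record pfun := PFun { dom : set R; val_of :> R -> {ffun N -> R} }.

(* To be used on an open set [U]: there, [derive1n i g] at [t] only depends
   on the restriction of [g] to [U]. *)
Definition smooth_on (U : set R) (g : R -> R) : Prop :=
  forall i t, U t -> derivable (derive1n i g) t 1.

Definition branch_regular (b : pfun) : Prop :=
  exists2 l0 : R, 0 < l0 &
    (dom b = `]- l0, l0[%classic /\
     forall c, smooth_on (dom b) (fun t => b t c)) \/
    ((dom b = `]- l0, 0]%classic \/ dom b = `[0, l0[%classic) /\
     forall c, {within dom b, continuous (fun t => b t c)} /\
               smooth_on (dom b `\ 0) (fun t => b t c)).

Definition equilibrium_branch (b : pfun) : Prop :=
  [/\ branch_regular b, b 0 = 0 &
      forall l, dom b l -> vector_field (b l) l = 0].

Definition branch_related (b1 b2 : pfun) : Prop :=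
  [/\ equilibrium_branch b1, equilibrium_branch b2 &
      exists U : set R, [/\ open U, U 0, U `&` dom b1 `&` dom b2 <> [set 0] &
        forall l, (U `&` dom b1 `&` dom b2) l -> b1 l = b2 l]].

Definition germ_equiv : pfun -> pfun -> Prop := clos_trans pfun branch_related.

(* The zero branches on the various domains are all germ equivalent. *)
Definition trivial_branch : pfun := PFun `]-1, 1[ (fun=> 0).

Definition bifurcation_branch (b : pfun) : Prop :=
  equilibrium_branch b /\ ~ germ_equiv b trivial_branch.

Definition in_synchrony (e : equiv_rel N) (x : {ffun N -> R}) : Prop :=
  forall c d, e c d -> x c = x d.

Definition lifted_from (N0 : network k) (b : pfun) : Prop :=
  exists e : equiv_rel N,
    [/\ balanced e, network_eq (quotient_network e) N0 &
        \forall l \near (0 : R), dom b l -> in_synchrony e (b l)].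

End VectorFields.

(* Main.v *)
Require Import Defs.
From mathcomp Require Import all_boot all_order all_algebra generic_quotient.
From mathcomp Require Import all_classical all_reals all_analysis.
From mathcomp Require Import ring lra zify.
Set Implicit Arguments.
Unset Strict Implicit.
Unset Printing Implicit Defensive.
Import Order.TTheory GRing.Theory Num.Theory.
Import numFieldNormedType.Exports.
Local Open Scope classical_set_scope.
Local Open Scope ring_scope.

(** Write [f00] and [f0p] for the second derivatives of [f] at the origin in
    the cell itself twice, and in the cell itself and the parameter.  Along an ultrafilter of parameters [l]
    tending to 0, every cell of a branch is either identically 0 or satisfies
    [f00 / 2 * x / |l| ^ (1 / 2 ^ q) --> a], where [a] is [+- f0p] for [q = 0]
    and [+- sqrt |\sum_i f_i * a_i|] for larger [q], the [a_i] being the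
    coefficients of the inputs of dominant order.  The generic condition is
    that [f00] is nonzero and that none of these finitely many sums vanishes.

    It is dense because of a valuation on the real field with 2 in its maximal
    ideal: if [f0p] is a unit and [f_i] is a unit times [2 ^ (B ^ i)] with [B]
    large, the terms of each sum have distinct valuations, as the digits of
    these valuations in base [B] show; and such values of the [f_i] are dense.

    Two split cells solve the same equation, whose roots have leading
    coefficients [0, a] or [a, - a] and are separated by the derivative of [f];
    so if the cells are not synchronous, their coefficients [(a1, a2)] are
    [(0, a)], [(a, 0)] or [(a, - a)].  A cell [d] with all inputs in the split
    satisfies [x_d ^ 2 ~ - (w1 * a1 + w2 * a2)] up to a positive factor, so both
    [d'] and [d''] have [w1 * a1 + w2 * a2 <= 0], which the sign hypotheses
    exclude in each of the three cases. *)

(** * Valuation rings of a field *)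

Section ValuationRing.
Variable K : numFieldType.
Implicit Types (A B : set K) (x y u : K).

Record subring_set A : Prop := SubringSet {
  subring_set1 : A 1;
  subring_setB : forall x y, A x -> A y -> A (x - y);
  subring_setM : forall x y, A x -> A y -> A (x * y)
}.

Section SubringTheory.
Variables (A : set K) (ringA : subring_set A).

Lemma subring_set0 : A 0.
Proof. by rewrite -(subrr 1); apply: subring_setB => //; case: ringA. Qed.

Lemma subring_setN x : A x -> A (- x).
Proof. by move=> ?; rewrite -sub0r; apply: subring_setB => //; exact: subring_set0. Qed.

Lemma subring_setD x y : A x -> A y -> A (x + y).
Proof. by move=> ? ?; rewrite -(opprK y); apply: subring_setB => //; apply: subring_setN. Qed.

Lemma subring_setX x n : A x -> A (x ^+ n).
Proof.
move=> Ax; elim: n => [|n IH]; first by rewrite expr0; case: ringA.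
by rewrite exprS; apply: subring_setM.
Qed.

Lemma subring_set_sum (I : Type) (r : seq I) (P : pred I) (F : I -> K) :
  (forall i, P i -> A (F i)) -> A (\sum_(i <- r | P i) F i).
Proof.
by move=> AF; elim/big_ind: _ => //; [exact: subring_set0|exact: subring_setD].
Qed.

Lemma subring_set_int (z : int) : A z%:~R.
Proof.
have An n : A n%:R.
  elim: n => [|n IH]; first exact: subring_set0.
  by rewrite -natr1; apply: subring_setD => //; case: ringA.
by case: z => n; [exact: An|rewrite NegzE mulrNz; apply/subring_setN/An].
Qed.

End SubringTheory.

Lemma maximal_subring_without_half : exists A, [/\ subring_set A, ~ A 2^-1 &
  forall B, subring_set B -> A `<=` B -> ~ B 2^-1 -> B `<=` A].
Proof.
(* The empty chain has the empty set as its union, so [P] asks for [1] only in nonempty sets.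
   Comparison with the integers later makes the maximal set nonempty. *)
pose P A := [/\ (A !=set0 -> A 1), forall x y, A x -> A y -> A (x - y),
  forall x y, A x -> A y -> A (x * y) & ~ A 2^-1].
have [|A [[A1 AB AM A2] maxA]] := @Zorn_bigcup K P.
  move=> F FP totF.
  have two x y : (\bigcup_(X in F) X) x -> (\bigcup_(X in F) X) y ->
      exists X, [/\ F X, X x & X y].
    move=> [X FX Xx] [Y FY Yy].
    by have [XY|YX] := totF _ _ FX FY; [exists Y|exists X]; split=> //; auto.
  split=> [[x [X FX Xx]]|x y /two/[apply]-[X [FX Xx Xy]]|
    x y /two/[apply]-[X [FX Xx Xy]]|[X /FP[] //]].
  - by exists X => //; have [X1 _ _ _] := FP _ FX; apply: X1; exists x.
  - by exists X => //; have [_ XB _ _] := FP _ FX; apply: XB.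
  - by exists X => //; have [_ _ XM _] := FP _ FX; apply: XM.
pose Z : set K := [set x | exists z : int, x = z%:~R].
have PZ : P Z.
  split=> [_|_ _ [a ->] [b ->]|_ _ [a ->] [b ->]|[a a2]].
  - by exists 1.
  - by exists (a - b); rewrite rmorphB.
  - by exists (a * b); rewrite rmorphM.
  - have : (2 * a)%:~R = 1 :> K by rewrite rmorphM /= -a2 mulfV // pnatr_eq0.
    by move/eqP; rewrite -(mulr1z 1) eqr_int => /eqP; lia.
have A0 : A !=set0.
  apply: contrapT => /set0P/negP; rewrite negbK => /eqP A0.
  suff /maxA/(_ PZ) : A `<` Z by [].
  by rewrite A0; split=> // /(_ 0); apply; exists 0.
have {}A1 := A1 A0.
exists A; split=> //.
move=> B [B1 BB BM] AB' B2; apply: contrapT => BA.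
suff /maxA : A `<` B by apply; split.
by split.
Qed.

Section Maximal.
Variable A : set K.
Hypotheses (ringA : subring_set A) (A2 : ~ A 2^-1).
Hypothesis maxA : forall B, subring_set B -> A `<=` B -> ~ B 2^-1 -> B `<=` A.

Let two_neq0 : 2 != 0 :> K. Proof. by rewrite pnatr_eq0. Qed.

(** Powers of [u = 1 - 2 * a] are congruent to [1] modulo [2 * A], so inverting [u] cannot bring in
    [2^-1]; by maximality the localization at [u] is [A] itself. *)
Lemma maximal_subring_inv a : A a -> A (1 - 2 * a)^-1.
Proof.
move=> Aa; set u := 1 - 2 * a.
have Au : A u.
  apply: subring_setB => //; first by case: ringA.
  apply: subring_setM => //; exact: (subring_set_int ringA 2).
have u0 : u != 0.
  apply/eqP => /eqP; rewrite subr_eq0 => /eqP a1; apply: A2.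
  suff -> : 2^-1 = a by [].
  by apply: (mulfI two_neq0); rewrite mulfV.
have uX s : exists2 c, A c & u ^+ s = 1 - 2 * c.
  elim: s => [|s [c Ac e]].
    by exists 0; [exact: subring_set0|rewrite expr0 mulr0 subr0].
  exists (a + c * u).
    by apply: subring_setD => //; apply: subring_setM.
  by rewrite exprS e /u; ring.
apply: (maxA (B := [set y | exists s, A (y * u ^+ s)])) => /=; last 1 first.
- by exists 1%N; rewrite expr1 mulVf //; case: ringA.
- split=> /=.
  + by exists 0%N; rewrite expr0 mulr1; case: ringA.
  + move=> x y [s As] [t At]; exists (s + t)%N.
    rewrite (_ : (x - y) * u ^+ (s + t) = x * u ^+ s * u ^+ t - y * u ^+ t * u ^+ s); last first.
      by rewrite exprD; ring.
    by apply: subring_setB => //; apply: subring_setM => //; apply: subring_setX.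
  + move=> x y [s As] [t At]; exists (s + t)%N.
    rewrite (_ : x * y * u ^+ (s + t) = x * u ^+ s * (y * u ^+ t)); last by rewrite exprD; ring.
    exact: subring_setM.
- by move=> x Ax; exists 0%N; rewrite expr0 mulr1.
- move=> [s As]; apply: A2; have [c Ac e] := uX s.
  rewrite (_ : 2^-1 = 2^-1 * u ^+ s + c); last first.
    by rewrite e mulrBr mulr1 mulKf // subrK.
  exact: subring_setD.
Qed.

(** Otherwise [A[x]] would be a strictly larger subring without [2^-1]. *)
Lemma maximal_subring_adjoin x : ~ A x ->
  exists2 p : {poly K}, (forall i, A p`_i) & p.[x] = 2^-1.
Proof.
move=> Ax; pose B := [set y | exists2 p : {poly K}, (forall i, A p`_i) & p.[x] = y].
apply: contrapT => B2; apply: Ax; apply: (maxA (B := B)) => //.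
- split.
  + exists 1; rewrite ?hornerE // => i; rewrite coef1.
    by case: (i == 0%N); [case: ringA|exact: subring_set0].
  + move=> _ _ [p Ap <-] [q Aq <-]; exists (p - q); rewrite ?hornerE // => i.
    by rewrite coefB; apply: subring_setB.
  + move=> _ _ [p Ap <-] [q Aq <-]; exists (p * q); rewrite ?hornerE // => i.
    by rewrite coefM; apply: subring_set_sum => // j _; apply: subring_setM.
- move=> a Aa; exists a%:P; rewrite ?hornerE // => i; rewrite coefC.
  by case: ifP => // _; exact: subring_set0.
- exists 'X; rewrite ?hornerE // => i; rewrite coefX.
  by case: (i == 1%N); [case: ringA|exact: subring_set0].
Qed.

(* Dividing the second relation by the unit [1 - 2 q_0] expresses [x ^+ m]
   through lower powers of [x], which lowers the degree of the first one. *)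
Lemma maximal_subring_reduce x (p q : {poly K}) : x != 0 ->
  (forall i, A p`_i) -> (forall i, A q`_i) ->
  p.[x] = 2^-1 -> q.[x^-1] = 2^-1 -> (size q <= size p)%N ->
  exists p' : {poly K},
    [/\ (forall i, A p'`_i), p'.[x] = 2^-1 & (size p' < size p)%N].
Proof.
move=> x0 Ap Aq px qx qp.
have q0 : q != 0.
  by apply/eqP => q0; move: qx; rewrite q0 horner0 => /esym/eqP; rewrite invr_eq0; apply/negP.
case Eq : (size q) (qp) => [|m]; first by move/eqP: Eq; rewrite size_poly_eq0 (negPf q0).
case Ep : (size p) => [//|n]; rewrite ltnS => mn.
pose u := 1 - 2 * q`_0.
have Au : A u^-1 by exact: maximal_subring_inv.
have u0 : u != 0.
  apply/eqP => /eqP; rewrite subr_eq0 => /eqP a1; apply: A2.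
  suff -> : 2^-1 = q`_0 by [].
  by apply: (mulfI two_neq0); rewrite mulfV.
pose r := \poly_(i < m) (2 * u^-1 * q`_(m - i)).
have Ar i : A r`_i.
  rewrite coef_poly; case: ifP => _; last exact: subring_set0.
  apply: subring_setM => //; apply: subring_setM => //.
  exact: (subring_set_int ringA 2).
have rx : r.[x] = x ^+ m.
  have e : 1 = 2 * q.[x^-1] by rewrite qx mulfV.
  rewrite (horner_coef_wide _ (leqnn _)) Eq big_ord_recl /= expr0 mulr1 mulrDr in e.
  have {e} e : u = 2 * \sum_(i < m) q`_(bump 0 i) * x^-1 ^+ bump 0 i.
    by rewrite /u {1}e addrC addKr.
  have e2 : x ^+ m = u^-1 * (x ^+ m * u) by rewrite mulrCA mulVf ?mulr1.
  rewrite e2 {2}e /r horner_poly mulr_sumr mulr_sumr mulr_sumr.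
  rewrite (reindex_inj rev_ord_inj) /=; apply: eq_bigr => i _.
  rewrite /bump /= add1n subKn; last exact: ltn_ord.
  have -> : x ^+ m = x ^+ (m - i.+1) * x ^+ i.+1 by rewrite -exprD subnK.
  rewrite exprVn; field.
  by rewrite u0 expf_neq0.
pose p' := \poly_(i < n) p`_i + p`_n *: ('X^(n - m) * r).
have sr : (size r <= m)%N by exact: size_poly.
exists p'; split.
- move=> i; rewrite coefD coefZ coefXnM coef_poly.
  apply: subring_setD => //; first by case: ifP => // _; exact: subring_set0.
  by apply: subring_setM => //; case: ifP => // _; exact: subring_set0.
- rewrite -px (horner_coef_wide x (leqnn (size p))) Ep big_ord_recr /=.
  rewrite hornerD hornerZ hornerM hornerXn horner_poly rx. by rewrite -exprD subnK.
- rewrite ltnS (leq_trans (size_polyD _ _)) // geq_max size_poly /=.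
  rewrite (leq_trans (size_scale_leq _ _)) //.
  rewrite (leq_trans (size_polyMleq _ _)) // size_polyXn addSn /=.
  by rewrite (leq_trans (leq_add (leqnn _) sr)) // subnK.
Qed.

(** If both fail, [A[x]] and [A[x^-1]] each give a polynomial relation for [2^-1]. One of the two
    can always be shortened, up to exchanging [x] and [x^-1]: an infinite descent on the sum of the
    sizes. *)
Lemma maximal_subring_valuation x : A x \/ A x^-1.
Proof.
apply: contrapT => /not_orP[Ax AxV].
have x0 : x != 0 by apply: contra_notN Ax => /eqP->; exact: subring_set0.
have [p Ap px] := maximal_subring_adjoin Ax.
have [q Aq qx] := maximal_subring_adjoin AxV.
have [n] := ubnP (size p + size q); elim: n => // n IH in x p q x0 {Ax AxV} Ap px Aq qx *.
rewrite ltnS => le; wlog qp : x x0 p q Ap px Aq qx le / (size q <= size p)%N.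
  move=> W; have [qp|/ltnW pq] := leqP (size q) (size p).
    exact: (W x x0 p q).
  by apply: (W x^-1 _ q p) => //; rewrite ?invr_eq0 ?invrK // addnC.
have [p' [Ap' p'x lt]] := maximal_subring_reduce x0 Ap Aq px qx qp.
by apply: (IH x p' q) => //; rewrite (leq_trans _ le) // ltn_add2r.
Qed.

End Maximal.

End ValuationRing.

(** * Valuations of sums *)

Section Valuation.
Variables (K : numFieldType) (A : set K).
Hypotheses (ringA : subring_set A) (A2 : ~ A 2^-1).
Hypothesis valA : forall x, A x \/ A x^-1.
Implicit Types x y z u : K.

(** In a valuation ring [x^-1] outside [A] forces [x] into [A], so this is membership in the maximal
    ideal. *)
Definition val_max x := x = 0 \/ ~ A x^-1.
Definition val_unit x := [/\ x != 0, A x & A x^-1].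

(* [val_exp q z n] says that z has valuation n / 2 ^ q, the valuation being
   normalized so that 2 has valuation 1. *)
Definition val_exp q z n := val_unit (z ^+ (2 ^ q) / 2 ^+ n).

Lemma val_max2 : val_max 2. Proof. by right. Qed.

Lemma val_maxMr x y : val_max x -> A y -> val_max (x * y).
Proof.
move=> [->|Ax] Ay; first by left; rewrite mul0r.
have [->|y0] := eqVneq y 0; first by left; rewrite mulr0.
right=> Axy; apply: Ax; rewrite (_ : x^-1 = (x * y)^-1 * y).
  exact: (subring_setM ringA).
by rewrite invfM mulfVK.
Qed.

(** One of the two quotients lies in [A], so the sum is a multiple in [A] of one of the summands. *)
Lemma val_maxD x y : val_max x -> val_max y -> val_max (x + y).
Proof.
wlog Axy : x y / A (x / y).
  move=> W mx my; have [Axy|Ayx] := valA (x / y); first exact: W.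
  by rewrite addrC; apply: W => //; rewrite -invf_div.
move=> mx my; have [y0|y0] := eqVneq y 0; first by rewrite y0 addr0.
rewrite (_ : x + y = y * (x / y + 1)); last first.
  by rewrite mulrDr mulr1 mulrC divfK.
by apply: val_maxMr => //; apply: (subring_setD ringA) => //; case: ringA.
Qed.

Lemma val_maxX x n : val_max (x ^+ n) -> val_max x.
Proof.
move=> [/eqP|xn]; first by rewrite expf_eq0 => /andP[_ /eqP->]; left.
by right=> Ax; apply: xn; rewrite -exprVn; exact: (subring_setX ringA).
Qed.

Lemma val_unit_max u : val_unit u -> ~ val_max u.
Proof. by move=> [/eqP u0 _ uV] [|]. Qed.

Lemma val_unit1 : val_unit 1.
Proof. by split; rewrite ?invr1 ?oner_eq0 //; case: ringA. Qed.

Lemma val_unitM x y : val_unit x -> val_unit y -> val_unit (x * y).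
Proof.
move=> [x0 Ax AxV] [y0 Ay AyV].
by split; rewrite ?mulf_neq0 ?invfM //; exact: (subring_setM ringA).
Qed.

Lemma val_unitV x : val_unit x -> val_unit x^-1.
Proof. by move=> [x0 Ax AxV]; split; rewrite ?invr_eq0 ?invrK. Qed.

Lemma val_unitN x : val_unit x -> val_unit (- x).
Proof.
move=> [x0 Ax AxV]; split; rewrite ?oppr_eq0 ?invrN //.
  exact: subring_setN.
exact: subring_setN.
Qed.

Lemma val_unitX x n : val_unit x -> val_unit (x ^+ n).
Proof.
move=> ux; elim: n => [|n IH]; first by rewrite expr0; exact: val_unit1.
by rewrite exprS; exact: val_unitM.
Qed.

Lemma val_unit_addmax u x : val_unit u -> val_max x -> val_unit (u + x).
Proof.
move=> uu mx; have [u0 Au AuV] := uu.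
have mu : ~ val_max (u + x).
  move=> mux; apply: (val_unit_max uu); rewrite -(addrK x u).
  apply: val_maxD => //; rewrite -mulrN1; apply: val_maxMr => //.
  by apply: subring_setN => //; case: ringA.
have [ux0 Aux] : u + x <> 0 /\ A (u + x)^-1.
  by split; [move=> ?|apply: contrapT => ?]; apply: mu; [left|right].
split=> //; first exact/eqP.
apply: (subring_setD ringA) => //.
case: mx => [->|AxV]; first exact: (subring_set0 ringA).
by case: (valA x).
Qed.

Lemma val_exp_neq0 q z n : val_exp q z n -> z != 0.
Proof.
move=> [zn _ _]; apply: contraNneq zn => ->.
by rewrite expr0n expn_eq0 /= mul0r.
Qed.

Lemma val_expM q x y n p : val_exp q x n -> val_exp q y p ->
  val_exp q (x * y) (n + p).
Proof.
rewrite /val_exp => ux uy; rewrite exprMn exprD invfM mulrACA.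
exact: val_unitM.
Qed.

(** The [2 ^ q]-th power of the quotient is [2] times an element of [A], and roots of elements of
    the maximal ideal stay in it. *)
Lemma val_exp_ratio q x y n p : val_exp q x n -> val_exp q y p -> (n < p)%N ->
  val_max (y / x).
Proof.
move=> ux uy np; apply: (@val_maxX _ (2 ^ q)).
have x0 := val_exp_neq0 ux.
have -> : (y / x) ^+ (2 ^ q) =
    2 * (2 ^+ (p - n).-1 * ((y ^+ (2 ^ q) / 2 ^+ p) / (x ^+ (2 ^ q) / 2 ^+ n))).
  rewrite mulrA -exprS prednK ?subn_gt0 // expr_div_n.
  have -> : 2 ^+ p = 2 ^+ (p - n) * 2 ^+ n :> K by rewrite -exprD subnK // ltnW.
  by field; rewrite !expf_neq0 // pnatr_eq0.
apply: val_maxMr; first exact: val_max2.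
apply: (subring_setM ringA).
  by apply: (subring_setX ringA); exact: (subring_set_int ringA 2).
by case: (val_unitM uy (val_unitV ux)).
Qed.

Lemma val_exp_unitM q x u n : val_exp q x n -> val_unit u ->
  val_exp q (x * u) n.
Proof.
rewrite /val_exp => ux uu; rewrite exprMn mulrAC.
by apply: val_unitM => //; exact: val_unitX.
Qed.

(** Factoring out the term of least valuation leaves [1] plus an element of the maximal ideal, which
    is a unit. *)
Lemma val_exp_sum q (I : finType) (S : {pred I}) (w : I -> K) (n : I -> nat) :
  (forall i, i \in S -> val_exp q (w i) (n i)) -> {in S &, injective n} ->
  (exists i, i \in S) ->
  exists2 i, i \in S & val_exp q (\sum_(i in S) w i) (n i).
Proof.
move=> wn injn [i0 Si0]; case: (arg_minnP n Si0) => i Si mini.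
exists i => //; rewrite (bigD1 i) //=.
have wi := wn _ Si; have wi0 := val_exp_neq0 wi.
rewrite -[X in X + _]mulr1 -[X in _ + X](mulVKf wi0) -mulrDr.
apply: val_exp_unitM => //; apply: val_unit_addmax; first exact: val_unit1.
rewrite mulr_sumr; elim/big_ind: _ => [||j /andP[Sj ji]]; first by left.
  exact: val_maxD.
rewrite mulrC; apply: (val_exp_ratio wi (wn _ Sj)).
rewrite ltn_neqAle mini // andbT; apply: contra ji => /eqP nij.
by apply/eqP/esym/injn.
Qed.

End Valuation.

(** The units used are odd integers divided by powers of [3]; odd integers are units, being [1]
    modulo [2]. *)
Lemma val_unit_dense (R : realType) (A : set R) (n : nat) (x e : R) :
  subring_set A -> ~ A 2^-1 -> (forall x, A x \/ A x^-1) -> 0 < e ->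
  exists2 u, val_unit A u & `|x - 2 ^+ n * u| < e.
Proof.
move=> ringA A2 valA e0.
have odd_unit z : val_unit A (1 + 2 * z%:~R).
  apply: val_unit_addmax => //; first exact: val_unit1.
  by apply: val_maxMr => //; [exact: val_max2|exact: subring_set_int].
have [s hs] : exists s, 2 ^+ n.+1 / e < 3 ^+ s :> R.
  exists (Num.bound (2 ^+ n.+1 / e)); apply: lt_le_trans (upper_nthrootP (leqnn _)) _.
  by rewrite lerXn2r ?nnegrE ?ler_nat.
(* [t] solves [x = 2 ^+ n * (1 + 2 * t) / 3 ^+ s] exactly; rounding it down to [z] costs at most
   [2 ^+ n.+1 / 3 ^+ s < e]. *)
pose t := (x * 3 ^+ s / 2 ^+ n - 1) / 2; pose z := Num.floor t.
have zt : z%:~R <= t < z%:~R + 1 by rewrite floor_le /= -intrD1 lt_succ_floor.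
have s0 : 0 < 3 ^+ s :> R by rewrite exprn_gt0.
have n0 : 0 < 2 ^+ n :> R by rewrite exprn_gt0.
have unit3 : val_unit A 3 by have := odd_unit 1; rewrite mulr1 -[1]/(1%:R) -natrD.
exists ((1 + 2 * z%:~R) / 3 ^+ s).
  by apply: val_unitM => //; apply: val_unitV; apply: val_unitX.
have -> : x - 2 ^+ n * ((1 + 2 * z%:~R) / 3 ^+ s) =
    2 ^+ n.+1 / 3 ^+ s * (t - z%:~R).
  by rewrite /t exprS; field; rewrite !gt_eqF.
have tz : `|t - z%:~R| <= 1 by rewrite ler_norml; apply/andP; split; lra.
have p0 : 0 <= 2 ^+ n.+1 / 3 ^+ s :> R by rewrite divr_ge0 ?exprn_ge0.
rewrite normrM ger0_norm //; apply: le_lt_trans (ler_wpM2l p0 tz) _.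
by rewrite mulr1 ltr_pdivrMr // mulrC -ltr_pdivrMr.
Qed.

Lemma digits_inj n B (c d : 'I_n -> nat) :
  (forall i, c i < B)%N -> (forall i, d i < B)%N ->
  (\sum_i c i * B ^ i = \sum_i d i * B ^ i)%N -> c =1 d.
Proof.
elim: n c d => [|n IH] c d cB dB; first by move=> _ [].
have B0 : (0 < B)%N by exact: leq_ltn_trans (cB ord0).
rewrite !big_ord_recl /= expn0 !muln1.
have shift (f : 'I_n.+1 -> nat) : (\sum_(i < n) f (lift ord0 i) * B ^ bump 0 i =
    (\sum_(i < n) f (lift ord0 i) * B ^ i) * B)%N.
  by rewrite big_distrl /=; apply: eq_bigr => i _; rewrite /bump add1n expnSr mulnA.
rewrite !shift => e.
have e0 : c ord0 = d ord0.
  by have := congr1 (modn^~ B) e; rewrite /= !(addnC _ (_ * B)%N) !modnMDl !modn_small.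
move: e; rewrite e0 => /addnI /eqP; rewrite eqn_pmul2r // => /eqP e i.
have [j ->|->//] := unliftP ord0 i.
exact: (IH (fun j => c (lift ord0 j)) (fun j => d (lift ord0 j))).
Qed.

(** * Nested radicals *)

Lemma cvg_sumr (R : numFieldType) (T I : Type) (F : set_system T) {FF : Filter F}
    (r : seq I) (f : I -> T -> R) (l : I -> R) : (forall i, f i x @[x --> F] --> l i) ->
  (\sum_(i <- r) f i x) @[x --> F] --> \sum_(i <- r) l i.
Proof.
move=> fl; elim: r => [|i r IH].
  by rewrite big_nil; under eq_fun do rewrite big_nil; exact: cvg_cst.
by rewrite big_cons; under eq_fun do rewrite big_cons; exact: cvgD.
Qed.

Section Trees.
Variable k : nat.

(* Distinguishing one input index together with its tree makes sure that every
   node has at least one nonzero input. *)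
Definition node_of (T : finType) : finType := ('I_k * T * {ffun 'I_k -> option T})%type.

(** A tree encodes a candidate for the leading coefficient of a cell at scale [|l| ^ (1 / 2 ^ q)]: a
    sign and, for [q > 0], the candidates of its inputs at the previous scale, [None] standing for
    coefficient 0. The type is finite, which leaves finitely many conditions on the jet. *)
Fixpoint tree (q : nat) : finType :=
  if q is q'.+1 then (node_of (tree q') * bool)%type else bool.

Definition node_input (T : finType) (nd : node_of T) (i : 'I_k) : option T :=
  if i == nd.1.1 then Some nd.1.2 else nd.2 i.

Variable R : realType.
Implicit Types (a : 'I_k -> R) (v : R).

Definition node_sum (T : finType) (val : T -> R) a (nd : node_of T) : R :=
  \sum_i a i * oapp val 0 (node_input nd i).

(** The absolute value gives every tree a value; on trees that arise from branches the node sum is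
    nonpositive. *)
Fixpoint tree_val a v q : tree q -> R :=
  match q with
  | 0 => fun s : bool => (-1) ^+ s * v
  | q'.+1 => fun t : node_of (tree q') * bool =>
      (-1) ^+ t.2 * Num.sqrt `|node_sum (@tree_val a v q') a t.1|
  end.

Definition nonresonant m a v : Prop :=
  forall q, (q <= m)%N -> forall nd : node_of (tree q),
    node_sum (@tree_val a v q) a nd != 0.

Lemma node_sum_continuous (T : topologicalType) (S : finType)
    (a : T -> 'I_k -> R) (val : T -> S -> R) (nd : node_of S) :
  (forall i, continuous (a ^~ i)) -> (forall s, continuous (val ^~ s)) ->
  continuous (fun z => node_sum (val z) (a z) nd).
Proof.
move=> ca cv z; apply: cvg_sumr => i.
apply: cvgM; first exact: ca.
by case: node_input => [s|] /=; [exact: cv|exact: cvg_cst].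
Qed.

Lemma tree_val_continuous (T : topologicalType) (a : T -> 'I_k -> R)
    (v : T -> R) q (t : tree q) : (forall i, continuous (a ^~ i)) ->
  continuous v -> continuous (fun z => tree_val (a z) (v z) t).
Proof.
move=> ca cv; elim: q t => [s|q IH t] z; first exact: (cvgMl_tmp (cv z)).
apply: cvgMl_tmp; apply: (@cvg_comp _ _ _ _ Num.sqrt); last exact: sqrt_continuous.
apply: cvg_norm.
exact: (@node_sum_continuous _ _ a (fun z => @tree_val (a z) (v z) q)).
Qed.

Lemma open_nonresonant (T : topologicalType) (a : T -> 'I_k -> R) (v : T -> R) m :
  (forall i, continuous (a ^~ i)) -> continuous v ->
  open [set z | nonresonant m (a z) (v z)].
Proof.
move=> ca cv; rewrite openE => z /= nr.
have : \forall y \near z, forall (q : 'I_m.+1) (nd : node_of (tree q)),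
    node_sum (@tree_val (a y) (v y) q) (a y) nd != 0.
  apply: filter_forall => q; apply: filter_forall => nd.
  apply: (cvgr_neq0 (node_sum (@tree_val (a z) (v z) q) (a z) nd)).
    by apply: node_sum_continuous => // t; exact: tree_val_continuous.
  by apply: nr; rewrite -ltnS.
apply: filterS => y ny q qm; exact: (ny (Ordinal (qm : (q < m.+1)%N))).
Qed.

Section Valuated.
Variables (A : set R) (m : nat) (a : 'I_k -> R) (v : R).
Hypotheses (ringA : subring_set A) (A2 : ~ A 2^-1).
Hypothesis valA : forall x, A x \/ A x^-1.
Let B := (2 ^ m.+1)%N.
Hypotheses (unit_a : forall i : 'I_k, val_unit A (a i / 2 ^+ (B ^ i))).
Hypothesis unit_v : val_unit A v.

(** The valuation of [z] times [2 ^ q] is written in base [B]. For [d <= B] the coefficients are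
    genuine digits, so that [digits_inj] applies. *)
Let has_digits d q (z : R) :=
  exists2 c : 'I_k -> nat, (\sum_i c i < d)%N &
    val_exp A q z (\sum_i c i * B ^ i).

(** The factor [a i] adds [2 ^ q] to digit [i], while the digits coming from the inputs stay below
    [2 ^ q]. So distinct nonzero terms have distinct valuations, and the sum has the valuation of
    one of them; [q <= m] keeps the digits below [B]. *)
Lemma node_sum_val_exp q (T : finType) (val : T -> R) (nd : node_of T) :
  (q <= m)%N -> (forall t, has_digits (2 ^ q) q (val t)) ->
  has_digits (2 ^ q.+1) q (node_sum val a nd).
Proof.
move=> qm hd.
have /choice[c /all_and2[cq vc]] : forall t, exists c : 'I_k -> nat,
    (\sum_i c i < 2 ^ q)%N /\ val_exp A q (val t) (\sum_i c i * B ^ i).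
  by move=> t; have [c] := hd t; exists c.
pose e i l := ((if node_input nd i is Some t then c t l else 0) + (l == i) * 2 ^ q)%N.
have e_sum i : node_input nd i -> (\sum_l e i l < 2 ^ q.+1)%N.
  move=> Si; rewrite /e big_split /= -big_distrl /= expnS mul2n -addnn.
  have -> : (\sum_(l < k) (l == i) = 1)%N.
    by rewrite (bigD1 i) //= eqxx big1 // => l /negPf->.
  rewrite mul1n ltn_add2r.
  by case: (node_input nd i) Si => [t _|].
have e_lt i l : node_input nd i -> (e i l < B)%N.
  move=> Si; apply: leq_trans (leq_trans (e_sum i Si) _).
    by rewrite ltnS (bigD1 l) //= leq_addr.
  by rewrite leq_exp2l.
have c_lt t l : (c t l < 2 ^ q)%N.
  by apply: leq_ltn_trans (cq t); rewrite (bigD1 l) //= leq_addr.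
pose S := [pred i | node_input nd i : bool].
pose n i := (\sum_l e i l * B ^ l)%N.
have Sn : {in S &, injective n}.
  move=> i j Si Sj; have ei l := e_lt i l Si; have ej l := e_lt j l Sj.
  move=> /(digits_inj ei ej)/(_ i); rewrite /e eqxx mul1n.
  have [//|ij] := eqVneq i j; rewrite mul0n addn0 => h; exfalso.
  move: Si Sj h; rewrite !inE.
  case: (node_input nd i) => // t _; case: (node_input nd j) => // t' _.
  by have := c_lt t' i; lia.
have Sw i : i \in S -> val_exp A q (a i * oapp val 0 (node_input nd i)) (n i).
  rewrite inE /n /e; case: (node_input nd i) => //= t _.
  have -> : (\sum_l (c t l + (l == i) * 2 ^ q) * B ^ l =
      2 ^ q * B ^ i + \sum_l c t l * B ^ l)%N.
    under eq_bigr do rewrite mulnDl.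
    rewrite big_split /= addnC; congr (_ + _)%N.
    by rewrite (bigD1 i) //= eqxx mul1n big1 ?addn0 // => l /negPf->.
  apply: val_expM => //; rewrite /val_exp.
  have -> : a i ^+ (2 ^ q) / 2 ^+ (2 ^ q * B ^ i) = (a i / 2 ^+ (B ^ i)) ^+ (2 ^ q).
    by rewrite expr_div_n mulnC exprM.
  exact: val_unitX.
have [|i Si vi] := val_exp_sum ringA A2 valA Sw Sn.
  by exists nd.1.1; rewrite inE /node_input eqxx.
exists (e i); first exact: e_sum.
rewrite /node_sum (bigID (mem S)) /= [X in _ + X]big1 ?addr0 // => l.
by rewrite inE; case: (node_input nd l) => //= _; rewrite mulr0.
Qed.

(** A square root halves the valuation while the normalizing factor [2 ^ q] doubles, so the digits
    do not change; signs are units. *)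
Lemma tree_val_exp q (t : tree q) :
  (q <= m.+1)%N -> has_digits (2 ^ q) q (tree_val a v t).
Proof.
elim: q t => [s _|q IH [nd s] /= qm].
  exists (fun=> 0%N); first by rewrite big1.
  rewrite /val_exp big1 // divr1 expr1 /=.
  by case: s; rewrite ?mulN1r ?mul1r //; exact: val_unitN.
have [c cq vc] := node_sum_val_exp nd (qm : (q <= m)%N) (IH ^~ (ltnW qm)).
exists c => //; move: vc; rewrite /val_exp expnS exprM.
set E := node_sum _ _ _; set n := (\sum_i _)%N.
have -> : ((-1) ^+ s * Num.sqrt `|E|) ^+ 2 = `|E|.
  by rewrite exprMn sqrr_sign mul1r sqr_sqrtr.
case: (ger0P E) => // _ uE; rewrite exprNn -mulrA; apply: val_unitM => //.
by apply: val_unitX => //; apply: val_unitN => //; exact: val_unit1.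
Qed.

Lemma valuated_nonresonant : nonresonant m a v.
Proof.
move=> q qm nd.
have [c _] := node_sum_val_exp nd qm (fun t => tree_val_exp t (leqW qm)).
exact: val_exp_neq0.
Qed.

End Valuated.
End Trees.

(** * Jets of quadratic perturbations *)

Section Quadratic.
Variables (R : realType) (n : nat).
Implicit Types (f g : 'rV[R]_n -> R) (d x : 'rV[R]_n) (M : 'M[R]_n).

Lemma is_derive_coord (v x : 'rV[R]_n) i :
  is_derive x v (fun y : 'rV[R]_n => y 0 i) (v 0 i).
Proof.
have lim : (fun h : R => h^-1 *: ((h *: v + x) 0 i - x 0 i)) @ 0^' --> v 0 i.
  apply: cvg_near_cst; near=> h.
  rewrite !mxE addrK /GRing.scale /= mulKf //.
  by near: h; exact: nbhs_dnbhs_neq.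
apply: DeriveDef; last exact: cvg_lim lim.
by apply/cvg_ex; exists (v 0 i).
Unshelve. all: by end_near. Qed.

(** The matrix need not be symmetric, so the Hessian is [M + M^T]. These functions are closed under
    partial derivatives, which makes smoothness and jets explicit. *)
Definition quad (c : R) d M x : R :=
  c + \sum_i d 0 i * x 0 i + \sum_i \sum_j M i j * (x 0 i * x 0 j).

Lemma is_derive_quad c d M l x : is_derive x (delta_mx 0 l) (quad c d M)
  (quad (d 0 l) (\row_i (M l i + M i l)) 0 x).
Proof.
pose X i : 'rV[R]_n -> R := fun y => y 0 i.
have DX i : is_derive x (delta_mx 0 l) (X i) (i == l)%:R.
  by have := is_derive_coord (delta_mx 0 l) x i; rewrite mxE eqxx.
have -> : quad c d M = cst c + \sum_i d 0 i *: X i +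
    \sum_i \sum_j M i j *: (X i * X j).
  apply/funext => y; rewrite /quad !addrfctE !fct_sumE; congr (_ + _).
  by apply: eq_bigr => i _; rewrite fct_sumE.
apply: is_derive_eq; rewrite add0r /quad.
have sumD (F : 'I_n -> R) : \sum_i F i * (i == l)%:R = F l.
  rewrite (bigD1 l) //= eqxx mulr1 big1 ?addr0 // => i /negPf->.
  by rewrite mulr0.
have -> : \sum_i \sum_j (0 : 'M[R]_n) i j * (x 0 i * x 0 j) = 0.
  by rewrite big1 // => i _; rewrite big1 // => j _; rewrite mxE mul0r.
rewrite addr0 [X in X + _]sumD; congr (_ + _).
have -> : \sum_i (\row_j (M l j + M j l)) 0 i * x 0 i =
    \sum_i M i l * x 0 i + \sum_j M l j * x 0 j.
  by rewrite -big_split /=; apply: eq_bigr => i _; rewrite mxE mulrDl addrC.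
rewrite -[X in _ = _ + X](sumD (fun i => \sum_j M i j * x 0 j)) -big_split /=.
apply: eq_bigr => i _; rewrite -(sumD (fun j => M i j * x 0 i)) big_distrl /=.
rewrite -big_split /=; apply: eq_bigr => j _.
by rewrite /GRing.scale /= /X; ring.
Qed.

Lemma pderiv_quad c d M l :
  pderiv l (quad c d M) = quad (d 0 l) (\row_i (M l i + M i l)) 0.
Proof. by apply/funext => x; have [_] := is_derive_quad c d M l x. Qed.

Lemma smooth_quad c d M : smooth (quad c d M).
Proof.
move=> s.
have [c' [d' [M' ->]]] : exists c' d' M', iter_pderiv s (quad c d M) = quad c' d' M'.
  elim: s => [|l s [c' [d' [M' e]]]]; first by exists c, d, M.
  rewrite /= -/(iter_pderiv s _) e pderiv_quad.
  by exists (d' 0 l), (\row_i (M' l i + M' i l)), 0.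
split=> [x|l x]; last by have [] := is_derive_quad c' d' M' l x.
have cX i : (fun y : 'rV[R]_n => y 0 i) @ x --> x 0 i.
  exact/differentiable_continuous/differentiable_coord.
have FF : Filter (nbhs x) := nbhs_filter x.
apply: (@cvgD _ _ _ (nbhs x)); last first.
  by apply: cvg_sumr => i; apply: cvg_sumr => j; apply: cvgMl_tmp; exact: cvgM.
apply: (@cvgD _ _ _ (nbhs x)); first exact: cvg_cst.
by apply: cvg_sumr => i; exact: cvgMl_tmp.
Qed.

Lemma jet2_quad d M : jet2 (quad 0 d M) = (d, M + M^T).
Proof.
have q0 c e : quad c e 0 0 = c.
  rewrite /quad; under eq_bigr do rewrite mxE mulr0.
  under [X in _ + X]eq_bigr do under eq_bigr do rewrite mxE mul0r.
  by rewrite !(big1_eq, addr0).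
congr pair; first by apply/rowP => i; rewrite mxE pderiv_quad q0.
by apply/matrixP => i j; rewrite !mxE !pderiv_quad q0 !mxE addrC.
Qed.

Section Sum.
Variables (f g : 'rV[R]_n -> R).
Hypotheses (sf : smooth f) (sg : smooth g).

Lemma iter_pderivD s : iter_pderiv s (f + g) = iter_pderiv s f + iter_pderiv s g.
Proof.
elim: s => [//|l s IH]; apply/funext => x.
rewrite /= -/(iter_pderiv s _) IH /pderiv deriveD //.
  by have [_] := sf s; apply.
by have [_] := sg s; apply.
Qed.

Lemma smoothD : smooth (f + g).
Proof.
move=> s; have [cf df] := sf s; have [cg dg] := sg s; rewrite iter_pderivD.
split=> [x|l x]; last exact: derivableD.
exact: (@cvgD _ _ _ (nbhs x) (nbhs_filter x) _ _ _ _ (cf x) (cg x)).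
Qed.

Lemma jet2D : jet2 (f + g) = ((jet2 f).1 + (jet2 g).1, (jet2 f).2 + (jet2 g).2).
Proof.
rewrite /jet2 /=; apply: f_equal2; [apply/rowP => i|apply/matrixP => i j].
  rewrite mxE [RHS]mxE [X in _ = X + _]mxE [X in _ = _ + X]mxE.
  exact: (congr1 (fun h => h 0) (iter_pderivD [:: i])).
rewrite mxE [RHS]mxE [X in _ = X + _]mxE [X in _ = _ + X]mxE.
exact: (congr1 (fun h => h 0) (iter_pderivD [:: i; j])).
Qed.

End Sum.
End Quadratic.

(** * Openness and density of the generic condition *)

Section GenericJets.
Variables (R : realType) (k : nat).

Definition ix_par : 'I_(1 + k + 1) := rshift (1 + k) ord0.

Lemma ix_cases (P : 'I_(1 + k + 1) -> Prop) :
  P (ix_self k) -> (forall i, P (ix_edge i)) -> P ix_par -> forall i, P i.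
Proof.
move=> Ps Pe Pp i; have [j ->|j ->] := split_ordP i; last by rewrite (ord1 j).
have [l ->|l ->] := split_ordP j; last exact: Pe.
by rewrite (ord1 l).
Qed.

Lemma sum_ix (F : 'I_(1 + k + 1) -> R) :
  \sum_i F i = F (ix_self k) + \sum_i F (ix_edge i) + F ix_par.
Proof. by rewrite !big_split_ord /= !big_ord1. Qed.

Lemma arg_point_self x (y : 'rV[R]_k) l : arg_point x y l 0 (ix_self k) = x.
Proof. by rewrite /arg_point !row_mxEl mxE eqxx. Qed.

Lemma arg_point_edge x (y : 'rV[R]_k) l i : arg_point x y l 0 (ix_edge i) = y 0 i.
Proof. by rewrite /arg_point row_mxEl row_mxEr. Qed.

Lemma arg_point_par x (y : 'rV[R]_k) l : arg_point x y l 0 ix_par = l.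
Proof. by rewrite /arg_point row_mxEr mxE eqxx. Qed.

Definition arg_pointE := (arg_point_self, arg_point_edge, arg_point_par).

Lemma quad_arg_point0 (d : 'rV[R]_(1 + k + 1)) (M : 'M[R]_(1 + k + 1)) l :
  d 0 ix_par = 0 -> M ix_par ix_par = 0 -> quad 0 d M (arg_point 0 0 l) = 0.
Proof.
move=> d0 M0; have x0 i : i != ix_par -> arg_point 0 (0 : 'rV[R]_k) l 0 i = 0.
  by move: i; apply: ix_cases => [|i|]; rewrite ?eqxx // !arg_pointE // mxE.
rewrite /quad add0r !big1 ?addr0 // => i _.
  rewrite big1 // => j _; have [->|/x0->] := eqVneq i ix_par; last by rewrite mul0r mulr0.
  by have [->|/x0->] := eqVneq j ix_par; rewrite ?M0 ?mul0r ?mulr0.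
by have [->|/x0->] := eqVneq i ix_par; rewrite ?d0 ?mul0r ?mulr0.
Qed.

Definition good_jets m : set ('rV[R]_(1 + k + 1) * 'M[R]_(1 + k + 1)) :=
  [set J : 'rV[R]_(1 + k + 1) * 'M[R]_(1 + k + 1) | J.2 (ix_self k) (ix_self k) != 0 /\
    nonresonant m (fun i => J.1 0 (ix_edge i)) (J.2 ix_par (ix_self k))].

Lemma open_good_jets m : open (good_jets m).
Proof.
have cc p q (i : 'I_p) (j : 'I_q) (N : 'M[R]_(p, q)) :
    (fun N' : 'M[R]_(p, q) => N' i j) @ N --> N i j.
  exact/differentiable_continuous/differentiable_coord.
have c1 i : continuous (fun J : 'rV[R]_(1 + k + 1) * 'M[R]_(1 + k + 1) => J.1 0 i : R).
  move=> J; apply: (@cvg_comp _ _ _ fst (fun r : 'rV[R]_(1 + k + 1) => r 0 i : R)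
    _ (nbhs J.1)); [exact: cvg_fst|exact: cc].
have c2 i j : continuous (fun J : 'rV[R]_(1 + k + 1) * 'M[R]_(1 + k + 1) => J.2 i j : R).
  move=> J; apply: (@cvg_comp _ _ _ snd (fun r : 'M[R]_(1 + k + 1) => r i j : R)
    _ (nbhs J.2)); [exact: cvg_snd|exact: cc].
apply: openI; last exact: open_nonresonant.
rewrite openE => J /= J0.
exact: (cvgr_neq0 (J.2 (ix_self k) (ix_self k)) (c2 _ _ J) J0).
Qed.

(** The two second derivatives are approximated by units and the [i]-th edge derivative by a unit
    times [2 ^+ (B ^ i)] with [B = 2 ^ m.+1], as the valuation argument requires. *)
Lemma good_jets_dense m (a : 'I_k -> R) (v s e : R) : 0 < e ->
  exists (a' : 'I_k -> R) (v' s' : R), [/\ nonresonant m a' v', s' != 0,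
    (forall i, `|a i - a' i| < e), `|v - v'| < e & `|s - s'| < e].
Proof.
move=> e0; have [A [ringA A2 maxA]] := maximal_subring_without_half R.
have valA := maximal_subring_valuation ringA A2 maxA.
have dense n x := val_unit_dense n x ringA A2 valA e0.
have [v' uv' vv'] := dense 0%N v; rewrite expr0 mul1r in vv'.
have [s' [s0 _ _] ss'] := dense 0%N s; rewrite expr0 mul1r in ss'.
have /choice[u /all_and2[uu au]] : forall i : 'I_k, exists u, val_unit A u /\
    `|a i - 2 ^+ ((2 ^ m.+1) ^ i) * u| < e.
  by move=> i; have [u] := dense ((2 ^ m.+1) ^ i)%N (a i); exists u.
exists (fun i : 'I_k => 2 ^+ ((2 ^ m.+1) ^ i) * u i), v', s'; split=> //.
apply: (valuated_nonresonant ringA A2 valA _ uv') => i.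
by rewrite mulrC mulKf // expf_neq0 // pnatr_eq0.
Qed.

Lemma ball_mxD p q (A D : 'M[R]_(p, q)) e : 0 < e ->
  (forall i j, `|D i j| < e) -> ball A e (A + D).
Proof.
by move=> e0 De; split=> // i j; rewrite mxE /ball /= opprD addNKr normrN.
Qed.

(** Adding a quadratic polynomial moves only the relevant derivatives to nearby good values. It
    vanishes on the parameter axis and has no linear term in the cell itself, so the sum stays in
    [VN0]. *)
Lemma generic_good_jets m :
  open_dense_in (@jet2 R (1 + k + 1) @` @VN0 R k)
    ((@jet2 R (1 + k + 1) @` @VN0 R k) `&` good_jets m).
Proof.
split; first by exists (good_jets m) => //; exact: open_good_jets.
move=> _ [f [[sf f0] fs0] <-] B /nbhs_ballP[e /= e0 eB].
set J := jet2 f in eB *.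
have [a' [v' [s' [nr s0 aa' vv' ss']]]] := good_jets_dense m
  (fun i => J.1 0 (ix_edge i)) (J.2 ix_par (ix_self k))
  (J.2 (ix_self k) (ix_self k)) e0.
pose d : 'rV[R]_(1 + k + 1) := arg_point 0 (\row_i (a' i - J.1 0 (ix_edge i))) 0.
(* In [M + M^T] a diagonal entry is counted twice, hence the half, and an off-diagonal one reaches
   both symmetric places. *)
pose M : 'M[R]_(1 + k + 1) :=
  ((s' - J.2 (ix_self k) (ix_self k)) / 2) *: delta_mx (ix_self k) (ix_self k) +
  (v' - J.2 ix_par (ix_self k)) *: delta_mx ix_par (ix_self k).
pose g := f + quad 0 d M.
have Jg : jet2 g = (J.1 + d, J.2 + (M + M^T)).
  by rewrite (jet2D sf (smooth_quad _ _ _)) jet2_quad.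
have ps : (ix_par == ix_self k) = false by [].
have es i : (ix_edge i == ix_self k) = false by [].
have ep i : (ix_edge i == ix_par) = false.
  by apply/negP => /eqP /(congr1 val) /=; have := ltn_ord i; lia.
have sp : (ix_self k == ix_par) = false by rewrite eq_sym.
have pe i : (ix_par == ix_edge i) = false by rewrite eq_sym.
have se i : (ix_self k == ix_edge i) = false by rewrite eq_sym.
have MM i j : (M + M^T) i j =
    (i == ix_self k)%:R * (j == ix_self k)%:R * (s' - J.2 (ix_self k) (ix_self k)) +
    ((i == ix_par)%:R * (j == ix_self k)%:R + (j == ix_par)%:R * (i == ix_self k)%:R) *
    (v' - J.2 ix_par (ix_self k)).
  rewrite /M !mxE; move: (s' - _) (v' - _) => x y.
  move: (i == ix_self k) (j == ix_self k) (i == ix_par) (j == ix_par) => [] [] [] [];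
    by rewrite /= ?(mulr0, mul0r, mulr1, mul1r, addr0, add0r) -?splitr; lra.
have small i j : `|(M + M^T) i j| < e.
  rewrite MM; move: i j; apply: ix_cases => [|i|]; apply: ix_cases => [|j|];
    rewrite ?(eqxx, ps, es, ep, sp, pe, se) /=;
    rewrite ?(mul0r, mulr0, mul1r, mulr1, add0r, addr0, normr0) // distrC //.
have smalld i : `|d 0 i| < e.
  move: i; apply: ix_cases => [|i|]; rewrite /d arg_pointE ?normr0 //.
  by rewrite mxE distrC.
exists (jet2 g); split.
  split.
    exists g; last by []; split; first split.
    - exact: smoothD sf (smooth_quad _ _ _).
    - move=> l; rewrite /g addrfctE f0 add0r; apply: quad_arg_point0; first exact: arg_point_par.
      by rewrite /M mxE [X in X + _]mxE [X in _ + X]mxE !mxE eqxx ps !mulr0 addr0.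
    - have : (jet2 g).1 0 (ix_self k) = 0.
        by rewrite Jg mxE arg_pointE addr0 mxE.
      by rewrite mxE.
  rewrite Jg; split.
    rewrite [_.2]/= mxE MM !(eqxx, sp) /= mulr1 mul1r !(mul0r, mul1r, add0r, addr0).
    by rewrite addrC subrK.
  rewrite [_.2]/= [_.1]/= mxE MM !(eqxx, ps) /= !(mul0r, mul1r, mulr1, add0r, addr0).
  rewrite addrC subrK.
  suff -> : (fun i => (J.1 + d) 0 (ix_edge i)) = a' by [].
  by apply/funext => i; rewrite mxE arg_pointE [X in _ + X]mxE addrC subrK.
by apply: eB; rewrite Jg; split; apply: ball_mxD => // i j; rewrite (ord1 i).
Qed.

End GenericJets.

(** * Taylor estimates *)

Section MeanValue.
Variable R : realType.

Lemma MVT_unordered (phi dphi : R -> R) : (forall t : R, is_derive t 1 phi (dphi t)) ->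
  forall x y, exists2 c, (x <= c <= y) || (y <= c <= x) &
    phi x - phi y = dphi c * (x - y).
Proof.
move=> D.
have cphi A : {within A, continuous phi}.
  apply: continuous_subspaceT => t; apply: differentiable_continuous.
  by apply/derivable1_diffP; have [] := D t.
have le x y : x <= y -> exists2 c, x <= c <= y & phi y - phi x = dphi c * (y - x).
  move=> xy; have [c cI e] := MVT_segment xy (fun t _ => D t) (cphi _).
  by exists c => //; rewrite in_itv in cI.
move=> x y; have [/le[c cI e]|/ltW/le[c cI e]] := leP x y; exists c => //.
- by rewrite cI.
- by rewrite -opprB e; ring.
- by rewrite cI orbT.
Qed.

Variable n : nat.
Implicit Types (g : 'rV[R]_n -> R) (z u v : 'rV[R]_n).

Lemma is_derive_line g z v : (forall x, derivable g x v) ->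
  forall t : R, is_derive t 1 (fun s => g (z + s *: v)) ('D_v g (z + t *: v)).
Proof.
move=> dg t.
have e : (fun h : R => h^-1 *: (((fun s => g (z + s *: v)) \o shift t) (h *: 1) -
      g (z + t *: v))) =
    (fun h : R => h^-1 *: ((g \o shift (z + t *: v)) (h *: v) - g (z + t *: v))).
  apply/funext => h /=; congr (_ *: (g _ - _)).
  have -> : h *: (1 : R) = h by exact: mulr1.
  by rewrite scalerDl addrCA.
by apply: DeriveDef; rewrite /derivable /derive e //; exact: dg.
Qed.

Lemma near0_box (P : 'rV[R]_n -> Prop) : (\forall z \near (0 : 'rV[R]_n), P z) ->
  exists2 d : R, 0 < d & forall z, (forall i, `|z 0 i| < d) -> P z.
Proof.
move=> /nbhs_ballP[d /= d0 dP]; exists d => // z zd; apply: dP; split=> // i j.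
by rewrite (ord1 i) mxE /ball /= sub0r normrN.
Qed.

(** The coordinates are changed from [v] to [u] one at a time, with the one-variable mean value
    theorem for each change; a box contains all intermediate points. *)
Lemma mean_value_box g (a : 'I_n -> R) (d e : R) :
  (forall i x, derivable g x (delta_mx 0 i)) ->
  (forall z, (forall i, `|z 0 i| < d) -> forall i, `|pderiv i g z - a i| <= e) ->
  forall u v, (forall i, `|u 0 i| < d) -> (forall i, `|v 0 i| < d) ->
    `|g u - g v - \sum_i a i * (u 0 i - v 0 i)| <= e * \sum_i `|u 0 i - v 0 i|.
Proof.
move=> dg bnd u v ud vd.
pose z j : 'rV[R]_n := \row_i (if (i < j)%N then u 0 i else v 0 i).
have -> : g u - g v = \sum_(i < n) (g (z i.+1) - g (z i)).
  rewrite -(big_mkord predT (fun i => g (z i.+1) - g (z i))) telescope_sumr //.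
  by congr (g _ - g _); apply/rowP => i; rewrite mxE ?ltn_ord.
rewrite -sumrB (le_trans (ler_norm_sum _ _ _)) // mulr_sumr ler_sum // => i _.
(* Both [z i] and [z i.+1] lie on the line through [w] in direction [i]. *)
pose w : 'rV[R]_n := \row_l (if l == i then 0 else z i 0 l).
have -> : z i.+1 = w + u 0 i *: delta_mx 0 i.
  apply/rowP => l; rewrite !mxE eqxx ltnS [(l <= i)%N]leq_eqVlt -val_eqE /=.
  by case: eqVneq => [/val_inj->|_]; rewrite ?(mulr1, add0r, mulr0, addr0).
have -> : z i = w + v 0 i *: delta_mx 0 i.
  apply/rowP => l; rewrite !mxE eqxx /=.
  case: eqVneq => [->|_]; last by rewrite mulr0 addr0.
  by rewrite ltnn mulr1 add0r.
have [c cb e1] := MVT_unordered (is_derive_line w (dg i)) (u 0 i) (v 0 i).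
rewrite e1 -mulrBl normrM ler_wpM2r // bnd // => l; rewrite !mxE.
case: eqVneq => [_|_]; rewrite eqxx /=.
  rewrite mulr1 add0r; have := ud i; have := vd i; rewrite !ltr_norml.
  by case/orP: cb; lra.
by rewrite mulr0 addr0; case: ifP.
Qed.

End MeanValue.

Section Expansion.
Variables (R : realType) (k : nat) (f : 'rV[R]_(1 + k + 1) -> R).
Hypothesis Vf : VN0 f.

Let sf : smooth f. Proof. by case: Vf => [[]]. Qed.
Let f0 l : f (arg_point 0 0 l) = 0. Proof. by case: Vf => [[]]. Qed.
Let fs0 : pderiv (ix_self k) f 0 = 0. Proof. by case: Vf. Qed.

Let f00 := pderiv (ix_self k) (pderiv (ix_self k) f) 0.
Let f0p := pderiv (ix_par k) (pderiv (ix_self k) f) 0.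

Lemma smooth_near_box s (e : R) : 0 < e -> exists2 d : R, 0 < d &
  forall z : 'rV[R]_(1 + k + 1), (forall i, `|z 0 i| < d) ->
  forall i, `|pderiv i (iter_pderiv s f) z - pderiv i (iter_pderiv s f) 0| <= e.
Proof.
move=> e0; set g := iter_pderiv s f.
suff H i : \forall z \near (0 : 'rV[R]_(1 + k + 1)),
    `|pderiv i g z - pderiv i g 0| <= e.
  exact: (near0_box (filter_forall (nbhs_filter _) H)).
have /cvgrPdist_le/(_ _ e0) := (sf (i :: s)).1 (0 : 'rV[R]_(1 + k + 1)).
by apply: filterS => z; rewrite distrC.
Qed.

Lemma arg_point_box x (y : 'I_k -> R) l d : `|x| < d -> (forall i, `|y i| < d) ->
  `|l| < d -> forall i, `|arg_point x (\row_i y i) l 0 i| < d.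
Proof. by move=> xd yd ld; apply: ix_cases => [|i|]; rewrite arg_pointE ?mxE. Qed.

(** The bound carries the factor [x1 - x2], which cancels when two solutions with the same inputs
    are compared. A crude constant [C] is enough for the inputs, which are negligible in that
    comparison. *)
Lemma expansion_self e : 0 < e -> exists C d : R, 0 < d /\
  forall x1 x2 (y : 'I_k -> R) l, `|x1| < d -> `|x2| < d ->
    (forall i, `|y i| < d) -> `|l| < d ->
  `|f (arg_point x1 (\row_i y i) l) - f (arg_point x2 (\row_i y i) l) -
    (x1 - x2) * (f00 * (x1 + x2) / 2 + f0p * l)| <=
  `|x1 - x2| * (e * (`|x1| + `|x2| + `|l|) + C * \sum_i `|y i|).
Proof.
move=> e0; have [d d0 bnd] := smooth_near_box [:: ix_self k] e0.
pose c i := pderiv (ix_edge i) (pderiv (ix_self k) f) 0.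
(* [C] collects the mixed derivatives in the cell itself and its inputs, absent from the quadratic
   model, and the mean value error on the input coordinates. *)
exists (\sum_i `|c i| + e), d; split=> // x1 x2 y l x1d x2d yd ld.
set Y := \sum_i `|y i|.
have argE x : arg_point x (\row_i y i) l =
    arg_point 0 (\row_i y i) l + x *: delta_mx 0 (ix_self k).
  apply/rowP => i; rewrite [RHS]mxE [X in _ = _ + X]mxE [X in _ = _ + _ * X]mxE eqxx /=.
  by move: i; apply: ix_cases => [|i|]; rewrite !arg_pointE ?mulr1 ?add0r ?mulr0 ?addr0.
pose z := arg_point 0 (\row_i y i) l.
have D t : is_derive t (1 : R) (fun s : R => f (z + s *: delta_mx 0 (ix_self k)) -
      (f00 / 2 * s ^+ 2 + f0p * l * s))
    (pderiv (ix_self k) f (z + t *: delta_mx 0 (ix_self k)) - (f00 * t + f0p * l)).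
  apply: is_deriveB; first exact: is_derive_line (fun x => (sf [::]).2 _ x) t.
  have -> : (fun s : R => f00 / 2 * s ^+ 2 + f0p * l * s) =
      (f00 / 2) \*: (id ^+ 2) + (f0p * l) \*: id by [].
  by apply: is_derive_eq; rewrite /GRing.scale /= expr1; field.
have [c0 cb] := MVT_unordered D x1 x2; rewrite -!argE => e1.
have -> : f (arg_point x1 (\row_i y i) l) - f (arg_point x2 (\row_i y i) l) -
    (x1 - x2) * (f00 * (x1 + x2) / 2 + f0p * l) =
    (pderiv (ix_self k) f (arg_point c0 (\row_i y i) l) - (f00 * c0 + f0p * l)) * (x1 - x2).
  by rewrite -e1; field.
rewrite normrM mulrC ler_wpM2l //.
have c0d : `|c0| < d.
  by move: x1d x2d; rewrite !ltr_norml; case/orP: cb; lra.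
have c0x : `|c0| <= `|x1| + `|x2|.
  have := ler_norm x1; have := ler_norm x2; have := ler_norm (- x1).
  have := ler_norm (- x2); rewrite !normrN ler_norml; case/orP: cb; lra.
have z0 : `|0 : R| < d by rewrite normr0.
have := mean_value_box (fun i x => (sf [:: ix_self k]).2 i x) bnd
  (arg_point_box c0d yd ld) (arg_point_box z0 (fun=> z0) z0).
have fs0' : pderiv (ix_self k) f (arg_point 0 (\row_(i < k) 0) 0) = 0.
  rewrite -[RHS]fs0; congr (pderiv _ _ _).
  by apply/rowP => i; rewrite [RHS]mxE; move: i; apply: ix_cases => [|i|];
    rewrite arg_pointE ?mxE.
rewrite !sum_ix !arg_pointE [iter_pderiv _ _ (arg_point 0 _ _)]fs0' !subr0.
under eq_bigr do rewrite !arg_pointE !mxE subr0.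
under [X in e * (_ + X + _)]eq_bigr do rewrite !arg_pointE !mxE subr0.
rewrite -/Y -[iter_pderiv _ _]/(pderiv (ix_self k) f) -/f00 -/f0p.
rewrite -[\sum_i _]/(\sum_i c i * y i).
have : `|\sum_i c i * y i| <= (\sum_i `|c i|) * Y.
  rewrite (le_trans (ler_norm_sum _ _ _)) // mulr_suml ler_sum // => i _.
  by rewrite normrM ler_wpM2l // /Y (bigD1 i) //= lerDl sumr_ge0.
move: (pderiv _ _ (arg_point _ _ _)) (\sum_i c i * y i) (\sum_i `|c i|) => p q r.
move=> qr H; rewrite (_ : p - _ = p - (f00 * c0 + q + f0p * l) + q); last by ring.
rewrite (le_trans (ler_normD _ _)) // (le_trans (lerD H qr)) //.
have := ler_wpM2l (ltW e0) c0x; lra.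
Qed.

(** The inputs are moved to 0 by the mean value estimate, then the cell itself by [expansion_self];
    the remaining value at [(0, 0, l)] is 0. *)
Lemma expansion e : 0 < e -> exists2 d : R, 0 < d &
  forall x (y : 'I_k -> R) l, `|x| < d -> (forall i, `|y i| < d) -> `|l| < d ->
  `|f (arg_point x (\row_i y i) l) -
    (\sum_i f_edge f i * y i + f00 / 2 * x ^+ 2 + f0p * l * x)| <=
  e * (\sum_i `|y i| + x ^+ 2 + `|l * x|).
Proof.
move=> e0; have [d d0 bnd] := smooth_near_box [::] e0.
have [C [d' [d'0 bnd']]] := expansion_self e0.
exists (Num.min d d'); first by rewrite lt_min d0.
move=> x y l; rewrite !lt_min => /andP[xd xd'] yd /andP[ld ld'].
have /all_and2[yd1 yd2] : forall i, `|y i| < d /\ `|y i| < d'.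
  by move=> i; apply/andP; rewrite -lt_min.
have zd : `|0 : R| < d by rewrite normr0.
have zd' : `|0 : R| < d' by rewrite normr0.
have sub_arg i : arg_point x (\row_i y i) l 0 (ix_edge i) -
    arg_point x (\row_(i < k) 0) l 0 (ix_edge i) = y i.
  by rewrite !arg_point_edge !mxE subr0.
have H2 : `|f (arg_point x (\row_i y i) l) - f (arg_point x (\row_(i < k) 0) l) -
    \sum_i f_edge f i * y i| <= e * \sum_i `|y i|.
  have := @mean_value_box R _ f (fun i => pderiv i f 0) d e
    (fun i x => (sf [::]).2 i x) bnd _ _
    (arg_point_box xd yd1 ld) (arg_point_box xd (fun=> zd) ld).
  cbv beta; rewrite !sum_ix.
  rewrite !(arg_point_self, arg_point_par) !subrr.
  have simp (a b c s t : R) :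
      `|c - (a * 0 + s + b * 0)| <= e * (`|0 : R| + t + `|0 : R|) -> `|c - s| <= e * t.
    by rewrite !mulr0 normr0 !addr0 !add0r.
  move=> /simp; move: (f _ - f _).
  under eq_bigr do rewrite sub_arg.
  suff -> : \sum_i `|arg_point x (\row_i0 y i0) l 0 (ix_edge i) -
      arg_point x (\row_(i0 < k) 0) l 0 (ix_edge i)| = \sum_i `|y i| by [].
  by apply: eq_bigr => i _; rewrite sub_arg.
have fz : f (arg_point 0 (\row_(i < k) 0) l) = 0.
  by rewrite -[RHS](f0 l); congr (f (arg_point _ _ _)); apply/rowP => i; rewrite !mxE.
have := bnd' x 0 (fun=> 0) l xd' zd' (fun=> zd') ld'.
rewrite fz normr0 big1_eq !subr0 mulr0 !addr0 => H1.
move: H1 H2; move: (f (arg_point x (\row_i y i) l)) (f (arg_point x (\row__ 0) l)).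
move: (\sum_i f_edge f i * y i) (\sum_i `|y i|) => s Y p q H1 H2.
rewrite (_ : p - _ = (p - q - s) + (q - x * (f00 * x / 2 + f0p * l))); last by field.
rewrite (le_trans (ler_normD _ _)) // (le_trans (lerD H2 H1)) //.
by rewrite normrM -[x ^+ 2]real_normK ?num_real // expr2; lra.
Qed.

End Expansion.

(** * Asymptotics of branches *)

Section CvgLemmas.
Variables (R : realType) (T : Type) (F : set_system T).
Context {FF : ProperFilter F}.
Implicit Types g h u : T -> R.

Lemma cvg_near_eq g h (a : R) : g @ F --> a ->
  (\forall l \near F, g l = h l) -> h @ F --> a.
Proof. by move=> ga e; apply: cvg_trans ga; exact: near_eq_cvg. Qed.

Lemma cvg0_bounded u g (C : R) : (\forall l \near F, `|u l| <= C) ->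
  g @ F --> 0 -> (fun l => u l * g l) @ F --> 0.
Proof.
move=> uC g0; apply/norm_cvg0P.
have C0 : (fun l => C * `|g l|) @ F --> (0 : R).
  by rewrite -(mulr0 C) -(normr0 R); apply: cvgMl_tmp; exact: cvg_norm.
apply: squeeze_cvgr (cvg_cst (0 : R)) C0.
by apply: filterS uC => l ul; rewrite normr_ge0 normrM ler_wpM2r.
Qed.

Lemma cvg_sum_norm n (y : 'I_n -> T -> R) (a : 'I_n -> R) :
  (forall i, y i @ F --> a i) -> (fun l => \sum_i `|y i l|) @ F --> \sum_i `|a i|.
Proof. by move=> ya; apply: cvg_sumr => i; exact: cvg_norm. Qed.

End CvgLemmas.

Section BranchAsymptotics.
Variables (R : realType) (k : nat) (f : 'rV[R]_(1 + k + 1) -> R).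
Hypothesis Vf : VN0 f.
Variable F : set_system R.
Context {FF : ProperFilter F}.
Hypothesis F0 : F --> (0 : R).

Let h := pderiv (ix_self k) (pderiv (ix_self k) f) 0 / 2.
Let f0p := pderiv (ix_par k) (pderiv (ix_self k) f) 0.
Hypothesis h0 : h != 0.

Lemma cvg0_near_lt (g : R -> R) d : 0 < d -> g @ F --> 0 -> \forall l \near F, `|g l| < d.
Proof. by move=> d0 g0; apply: (cvgr0_norm_lt g). Qed.

(** The estimates for all [e] are packed into one factor [r] tending to 0. Where the denominator
    [D l] vanishes, so does the error, and the quotient with default value 0 still fits. *)
Lemma expansion_cvg (x : R -> R) (y : 'I_k -> R -> R) :
  x @ F --> 0 -> (forall i, y i @ F --> 0) ->
  exists2 r : R -> R, r @ F --> 0 & \forall l \near F,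
    f (arg_point (x l) (\row_i y i l) l) =
    \sum_i f_edge f i * y i l + h * x l ^+ 2 + f0p * l * x l +
    r l * (\sum_i `|y i l| + x l ^+ 2 + `|l * x l|).
Proof.
move=> x0 y0.
pose err l := f (arg_point (x l) (\row_i y i l) l) -
  (\sum_i f_edge f i * y i l + h * x l ^+ 2 + f0p * l * x l).
pose D l := \sum_i `|y i l| + x l ^+ 2 + `|l * x l|.
have D0 l : 0 <= D l by rewrite !addr_ge0 ?sqr_ge0 ?sumr_ge0.
have bnd e : 0 < e -> \forall l \near F, `|err l| <= e * D l.
  move=> e0; have [d d0 H] := expansion Vf e0.
  near=> l; apply: H.
  - by near: l; exact: cvg0_near_lt.
  - by near: l; apply: filter_forall => i; exact: cvg0_near_lt.
  - by near: l; exact: cvg0_near_lt F0.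
exists (fun l => err l / D l).
  apply/cvgr0Pnorm_le => e e0; apply: filterS (bnd e e0) => l errD.
  rewrite normrM normfV (ger0_norm (D0 l)).
  have [->|Dl] := eqVneq (D l) 0; first by rewrite invr0 mulr0 ltW.
  by rewrite ler_pdivrMr // lt_def Dl D0.
apply: filterS (bnd 1 ltr01) => l errD; rewrite -/(D l).
have [Dl|Dl] := eqVneq (D l) 0.
  move: errD; rewrite Dl !mulr0 normr_le0 subr_eq0 => /eqP ->.
  by rewrite addr0.
by rewrite divfK // /err addrC subrK.
Unshelve. all: by end_near. Qed.

Variable x : R -> R.
Variable y : 'I_k -> R -> R.
Hypotheses (x0 : x @ F --> 0) (y0 : forall i, y i @ F --> 0).

Section Scaled.
Variable rho : R -> R.
Hypothesis rho_gt0 : \forall l \near F, 0 < rho l.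
Hypothesis l_rho : \forall l \near F, `|l| <= rho l.

(** After division by [rho] the square term balances the inputs: the mixed term is negligible
    because [l / rho l] is bounded and [x] tends to 0. *)
Lemma branch_square_cvg (eta : 'I_k -> R) :
  (\forall l \near F, f (arg_point (x l) (\row_i y i l) l) = 0) ->
  (forall i, (fun l => h * y i l / rho l) @ F --> eta i) ->
  (fun l => (h * x l) ^+ 2 / rho l) @ F --> - \sum_i f_edge f i * eta i.
Proof.
move=> fx yeta; have [r r0 fE] := expansion_cvg x0 y0.
have lx0 : (fun l => l / rho l * x l) @ F --> 0.
  apply: (cvg0_bounded (C := 1)) => //.
  near=> l; rewrite normrM normfV.
  have rl : 0 < rho l by near: l.
  by rewrite (gtr0_norm rl) ler_pdivrMr // mul1r; near: l.
(* The part [r l * x l ^+ 2] of the remainder is absorbed into the square term as the factor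
   [1 + r l / h]. *)
have den : (fun l => 1 + r l / h) @ F --> (1 : R).
  by rewrite -[X in _ --> X]addr0 -(mul0r h^-1); apply: cvgD; [exact: cvg_cst|exact: cvgMr_tmp].
have num : (fun l => - (\sum_i f_edge f i * (h * y i l / rho l) +
    f0p * h * (l / rho l * x l) + r l * (h / `|h| * \sum_i `|h * y i l / rho l| +
      h * `|l / rho l * x l|))) @ F --> - (\sum_i f_edge f i * eta i + f0p * h * 0 +
      0 * (h / `|h| * \sum_i `|eta i| + h * `|0 : R|)).
  apply: cvgN; apply: cvgD; first apply: cvgD.
  - by apply: cvg_sumr => i; exact: cvgMl_tmp.
  - exact: cvgMl_tmp.
  - apply: cvgM => //; apply: cvgD; apply: cvgMl_tmp; last exact: cvg_norm.
    exact: cvg_sum_norm.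
have FF' : Filter F by typeclasses eauto.
have := cvgM (FF := FF') num (cvgV (FF := FF') (oner_neq0 _) den).
rewrite !mulr0 !mul0r !addr0 invr1 mulr1 => lim; apply: (cvg_near_eq lim); near=> l => /=.
have rl : 0 < rho l by near: l.
have dl : 1 + r l / h != 0.
  by near: l; apply: (cvgr_neq0 (1 : R)) => //; exact: oner_neq0.
have : \sum_i f_edge f i * y i l + h * x l ^+ 2 + f0p * l * x l +
    r l * (\sum_i `|y i l| + x l ^+ 2 + `|l * x l|) = 0.
  transitivity (f (arg_point (x l) (\row_i y i l) l)); last by near: l.
  by apply: esym; near: l.
have -> : \sum_i f_edge f i * (h * y i l / rho l) = h / rho l * \sum_i f_edge f i * y i l.
  by rewrite mulr_sumr; apply: eq_bigr => i _; ring.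
have -> : \sum_i `|h * y i l / rho l| = `|h| / rho l * \sum_i `|y i l|.
  rewrite mulr_sumr; apply: eq_bigr => i _.
  by rewrite !normrM !normfV (gtr0_norm rl); ring.
have -> : `|l / rho l * x l| = `|l * x l| / rho l.
  by rewrite !normrM normfV (gtr0_norm rl); ring.
move: (\sum_i _ * _) (\sum_i `|_|) `|l * x l| => S Y A e.
apply: (mulIf dl); rewrite mulfVK //.
have nh : `|h| != 0 by rewrite normr_eq0.
transitivity (- (h / rho l) * (S + f0p * l * x l + r l * (Y + A))).
  by field; rewrite nh gt_eqF.
have -> : S + f0p * l * x l + r l * (Y + A) = - (h * x l ^+ 2 + r l * x l ^+ 2).
  by apply/eqP; rewrite -subr_eq0 opprK -[X in _ == X]e; apply/eqP; ring.
by field; rewrite h0 gt_eqF.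
Unshelve. all: by end_near. Qed.

(** Where [x l] and [x' l] differ, the difference of their equations can be divided by [x l - x' l];
    at scale [rho] this bounds the absolute value of [2 * a + f0p * c] by half of itself. *)
Lemma branch_separation (x' : R -> R) (a c : R) : x' @ F --> 0 ->
  (\forall l \near F, f (arg_point (x l) (\row_i y i l) l) = 0) ->
  (\forall l \near F, f (arg_point (x' l) (\row_i y i l) l) = 0) ->
  (fun l => h * x l / rho l) @ F --> a -> (fun l => h * x' l / rho l) @ F --> a ->
  (forall i, (fun l => y i l / rho l) @ F --> 0) ->
  (fun l => l / rho l) @ F --> c -> 2 * a + f0p * c != 0 ->
  \forall l \near F, x l = x' l.
Proof.
move=> x'0 fx fx' xa xa' yr lc ac.
have FF' : Filter F by typeclasses eauto.
(* The summand 1 keeps [K] positive, and [e] is chosen so that [e * K] is half of the nonzero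
   limit. *)
pose K := 2 * `|a / h| + `|c| + 1.
have K0 : 0 < K by rewrite /K ltr_pwDr // addr_ge0 // mulr_ge0.
pose e := `|2 * a + f0p * c| / (2 * K).
have e0 : 0 < e by rewrite divr_gt0 ?normr_gt0 ?mulr_gt0.
have [C [d [d0 H]]] := expansion_self Vf e0.
have xr u : (fun l => h * u l / rho l) @ F --> a -> (fun l => u l / rho l) @ F --> a / h.
  move=> /(cvgMr_tmp (FF := FF') (b := h^-1)) ur; apply: (cvg_near_eq ur).
  by near=> l; field; rewrite h0 /= gt_eqF //; near: l.
have G : (fun l => `|h * x l / rho l + h * x' l / rho l + f0p * (l / rho l)| -
    (e * (`|x l / rho l| + `|x' l / rho l| + `|l / rho l|) +
     C * \sum_i `|y i l / rho l|)) @ F -->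
    `|a + a + f0p * c| - (e * (`|a / h| + `|a / h| + `|c|) + C * \sum_(i < k) `|0 : R|).
  apply: cvgB.
    by apply: cvg_norm; apply: cvgD; [exact: cvgD|exact: cvgMl_tmp].
  apply: cvgD; apply: cvgMl_tmp; last exact: (cvg_sum_norm yr).
  apply: cvgD; last exact: cvg_norm.
  by apply: cvgD; apply: cvg_norm; exact: xr.
have {}G := cvgr_gt _ G 0 _.
near=> l; apply/eqP; rewrite -subr_eq0.
have rl : 0 < rho l by near: l.
have : 0 < `|h * x l / rho l + h * x' l / rho l + f0p * (l / rho l)| -
    (e * (`|x l / rho l| + `|x' l / rho l| + `|l / rho l|) +
     C * \sum_i `|y i l / rho l|).
  near: l; apply: G; rewrite normr0 big1_eq mulr0 addr0.
  have eK : e * K = `|2 * a + f0p * c| / 2 by rewrite /e; field; rewrite gt_eqF.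
  have -> : a + a = 2 * a by ring.
  have -> : e * (`|a / h| + `|a / h| + `|c|) = e * K - e by rewrite /K; ring.
  have : 0 <= `|2 * a + f0p * c| by [].
  by rewrite eK; lra.
apply: contraTT => xx'.
have -> : \sum_i `|y i l / rho l| = (\sum_i `|y i l|) / rho l.
  rewrite mulr_suml; apply: eq_bigr => i _.
  by rewrite normrM normfV (gtr0_norm rl).
have -> : h * x l / rho l + h * x' l / rho l + f0p * (l / rho l) =
  (h * (x l + x' l) + f0p * l) / rho l by field; rewrite gt_eqF.
rewrite !normrM !normfV (gtr0_norm rl) -leNgt subr_le0.
have -> : e * (`|x l| / rho l + `|x' l| / rho l + `|l| / rho l) +
    C * ((\sum_i `|y i l|) / rho l) = (e * (`|x l| + `|x' l| + `|l|) +
    C * \sum_i `|y i l|) / rho l by ring.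
rewrite ler_pM2r ?invr_gt0 //.
have xx'0 : 0 < `|x l - x' l| by rewrite normr_gt0.
rewrite -(ler_pM2l xx'0) -normrM.
have xd : `|x l| < d by near: l; exact: cvg0_near_lt.
have xd' : `|x' l| < d by near: l; exact: cvg0_near_lt.
have ld : `|l| < d by near: l; exact: cvg0_near_lt F0.
have yd i : `|y i l| < d.
  by move: i; near: l; apply: filter_forall => i; exact: cvg0_near_lt.
have := H (x l) (x' l) (y ^~ l) l xd xd' yd ld.
rewrite (_ : f (arg_point (x l) _ l) = 0); last by near: l.
rewrite (_ : f (arg_point (x' l) _ l) = 0); last by near: l.
rewrite subrr sub0r normrN (_ : (x l - x' l) * (_ * _ / 2 + _) =
  (x l - x' l) * (h * (x l + x' l) + f0p * l)) //.
by congr (_ * (_ + _)); rewrite /h mulrAC.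
Unshelve. all: by end_near. Qed.

End Scaled.

(** With zero inputs, division by [l * x l] leaves [h * x l / l * (1 + r l / h)] equal to [- f0p] up
    to an error tending to 0. *)
Lemma branch_trivial_inputs :
  (\forall l \near F, f (arg_point (x l) (\row_i y i l) l) = 0) ->
  (forall i, \forall l \near F, y i l = 0) ->
  (\forall l \near F, x l != 0) -> (\forall l \near F, l != 0) ->
  (fun l => h * x l / l) @ F --> - f0p.
Proof.
move=> fx yz xn ln; have [r r0 fE] := expansion_cvg x0 y0.
have FF' : Filter F by typeclasses eauto.
have den : (fun l => 1 + r l / h) @ F --> (1 : R).
  by rewrite -[X in _ --> X]addr0 -(mul0r h^-1); apply: cvgD; [exact: cvg_cst|exact: cvgMr_tmp].
have sr : (fun l => `|l * x l| / (l * x l) * r l) @ F --> 0.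
  apply: (cvg0_bounded (C := 1)) => //; near=> l.
  rewrite normrM normfV normr_id divff // normr_eq0 mulf_neq0 //; near: l => //.
have num : (fun l => - (f0p + `|l * x l| / (l * x l) * r l)) @ F --> - (f0p + 0).
  by apply: cvgN; apply: cvgD => //; exact: cvg_cst.
have := cvgM (FF := FF') num (cvgV (FF := FF') (oner_neq0 _) den).
rewrite addr0 invr1 mulr1 => lim; apply: (cvg_near_eq lim); near=> l => /=.
have dl : 1 + r l / h != 0.
  by near: l; apply: (cvgr_neq0 (1 : R)) => //; exact: oner_neq0.
have l0 : l != 0 by near: l.
have xl0 : x l != 0 by near: l.
have : \sum_i f_edge f i * y i l + h * x l ^+ 2 + f0p * l * x l +
    r l * (\sum_i `|y i l| + x l ^+ 2 + `|l * x l|) = 0.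
  transitivity (f (arg_point (x l) (\row_i y i l) l)); last by near: l.
  by apply: esym; near: l.
have yl i : y i l = 0 by move: i; near: l; exact: filter_forall.
rewrite !big1 => [|i _|i _]; rewrite ?yl ?normr0 ?mulr0 // !add0r.
move: `|l * x l| => A e.
apply: (mulIf dl); rewrite mulfVK //.
transitivity (- (f0p * l * x l + r l * A) / (l * x l)).
  field. by rewrite ?l0 ?xl0.
have -> : f0p * l * x l + r l * A = - (h * x l ^+ 2 + r l * x l ^+ 2).
  by apply/eqP; rewrite -subr_eq0 opprK -[X in _ == X]e; apply/eqP; ring.
by field; rewrite h0 l0.
Unshelve. all: by end_near. Qed.

(** Since [f_0 = 0], the linear part is [\sum_i f_edge f i] times [x l], and all other terms are
    [x l] times factors tending to 0. *)
Lemma branch_loop : (forall i, y i = x) ->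
  (\forall l \near F, f (arg_point (x l) (\row_i y i l) l) = 0) ->
  \sum_i f_edge f i != 0 -> \forall l \near F, x l = 0.
Proof.
move=> yx fx S0; have [r r0 fE] := expansion_cvg x0 y0.
have G : (fun l => `|h * x l| + `|f0p * l| + `|r l| * (k%:R + `|x l| + `|l|)) @ F -->
    `|h * 0| + `|f0p * 0| + `|0 : R| * (k%:R + `|0 : R| + `|0 : R|).
  have F0' : (fun l : R => l) @ F --> (0 : R) by exact: F0.
  apply: cvgD; first by apply: cvgD; apply: cvg_norm; exact: cvgMl_tmp.
  apply: cvgM; first exact: cvg_norm.
  apply: cvgD; last exact: cvg_norm.
  by apply: cvgD; [exact: cvg_cst|exact: cvg_norm].
rewrite !mulr0 normr0 mul0r !addr0 in G.
have {}G := cvgr_lt _ G `|\sum_i f_edge f i| _.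
near=> l.
have : `|h * x l| + `|f0p * l| + `|r l| * (k%:R + `|x l| + `|l|) < `|\sum_i f_edge f i|.
  by near: l; apply: G; rewrite normr_gt0.
apply: contraTeq => xl0; rewrite -leNgt.
have : \sum_i f_edge f i * y i l + h * x l ^+ 2 + f0p * l * x l +
    r l * (\sum_i `|y i l| + x l ^+ 2 + `|l * x l|) = 0.
  transitivity (f (arg_point (x l) (\row_i y i l) l)); last by near: l.
  by apply: esym; near: l.
under eq_bigr do rewrite yx.
under [\sum_i `|_|]eq_bigr do rewrite yx.
rewrite -mulr_suml sumr_const card_ord => e.
have {}e : (\sum_i f_edge f i) * x l = - ((h * x l + f0p * l) * x l +
    r l * (`|x l| *+ k + x l ^+ 2 + `|l * x l|)).
  by apply/eqP; rewrite -subr_eq0 opprK -[X in _ == X]e; apply/eqP; ring.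
have xl1 : 0 < `|x l| by rewrite normr_gt0.
rewrite -(ler_pM2r xl1) -normrM e normrN.
rewrite (le_trans (ler_normD _ _)) // [leRHS]mulrDl lerD //.
  by rewrite normrM ler_wpM2r // ler_normD.
rewrite normrM -mulrA ler_wpM2l // ger0_norm; last first.
  by rewrite !addr_ge0 ?sqr_ge0 ?mulrn_wge0.
rewrite le_eqVlt; apply/orP; left; apply/eqP.
by rewrite normrM -mulr_natl -[x l ^+ 2]real_normK ?num_real //; ring.
Unshelve. all: by end_near. Qed.

End BranchAsymptotics.

(** The square determines the limit of the absolute value, and an ultrafilter decides the sign of
    [u]. *)
Lemma ultra_sqrt_cvg (R : realType) (T : Type) (F : set_system T)
    (u : T -> R) (a : R) : UltraFilter F ->
  (fun l => u l ^+ 2) @ F --> a -> exists s : bool, u @ F --> (-1) ^+ s * Num.sqrt a.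
Proof.
move=> UF ua; have FF : ProperFilter F by typeclasses eauto.
have su : (fun l => `|u l|) @ F --> Num.sqrt a.
  have : (fun l => Num.sqrt (u l ^+ 2)) @ F --> Num.sqrt a.
    exact: (cvg_comp _ _ ua (@sqrt_continuous R a)).
  by move=> lim; apply: (cvg_near_eq lim); apply: nearW => l; rewrite sqrtr_sqr.
have [u0|u0] := in_ultra_setVsetC [set l | 0 <= u l] UF.
  exists false; rewrite mul1r; apply: (cvg_near_eq su).
  by apply: filterS u0 => l ul; rewrite ger0_norm.
exists true; rewrite mulN1r; apply: (cvg_near_eq (cvgN su)).
apply: filterS u0 => l /negP; rewrite -ltNge => ul.
by rewrite fctE ltr0_norm // opprK.
Qed.

(** * Iterated square roots of the parameter *)

Section RootScale.
Variables (R : realType).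

Definition root_scale q (l : R) : R := iter q Num.sqrt `|l|.

Lemma root_scale_ge0 q l : 0 <= root_scale q l.
Proof. by case: q => [|q] //=; exact: sqrtr_ge0. Qed.

Lemma root_scale_gt0 q l : l != 0 -> 0 < root_scale q l.
Proof. by move=> l0; elim: q => [|q IH]; rewrite /= ?normr_gt0 // sqrtr_gt0. Qed.

Lemma root_scaleS q l : root_scale q.+1 l ^+ 2 = root_scale q l.
Proof. by rewrite /= sqr_sqrtr // root_scale_ge0. Qed.

Lemma root_scale_le1 q l : `|l| <= 1 -> root_scale q l <= 1.
Proof.
by move=> l1; elim: q => [|q IH] //=; rewrite -sqrtr1 ler_sqrt.
Qed.

Lemma root_scale_leS q l : `|l| <= 1 -> root_scale q l <= root_scale q.+1 l.
Proof.
move=> l1; rewrite -root_scaleS expr2 ler_piMr ?root_scale_ge0 //.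
exact: root_scale_le1.
Qed.

Lemma root_scale_le p q l : `|l| <= 1 -> (p <= q)%N -> root_scale p l <= root_scale q l.
Proof.
move=> l1; elim: q => [|q IH]; first by rewrite leqn0 => /eqP->.
rewrite leq_eqVlt => /predU1P[->//|]; rewrite ltnS => /IH le.
exact: le_trans le (root_scale_leS _ l1).
Qed.

Variable F : set_system R.
Context {FF : ProperFilter F}.
Hypotheses (F0 : F --> (0 : R)) (ln0 : \forall l \near F, l != 0).

Lemma root_scale_cvg0 q : root_scale q @ F --> 0.
Proof.
elim: q => [|q IH].
  have F0' : (fun l : R => l) @ F --> (0 : R) by exact: F0.
  have lim : (fun l : R => `|l|) @ F --> `|0 : R| by exact: cvg_norm.
  by rewrite normr0 in lim.
by have := cvg_comp _ _ IH (@sqrt_continuous R 0); rewrite sqrtr0.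
Qed.

Lemma near_root_scale_gt0 q : \forall l \near F, 0 < root_scale q l.
Proof. by apply: filterS ln0 => l; exact: root_scale_gt0. Qed.

Lemma near_norm_le1 : \forall l \near F, `|l| <= 1.
Proof. by apply: filterS (cvg0_near_lt ltr01 F0) => l /ltW. Qed.

Lemma near_le_root_scale q : \forall l \near F, `|l| <= root_scale q l.
Proof. by apply: filterS near_norm_le1 => l l1; exact: (root_scale_le l1 (leq0n q)). Qed.

(** As [root_scale p] is the square of [root_scale p.+1], its ratio to [root_scale q] is at most
    [root_scale p.+1]. *)
Lemma root_scale_ratio_cvg0 p q (u : R -> R) (a : R) : (p < q)%N ->
  (fun l => u l / root_scale p l) @ F --> a ->
  (fun l => u l / root_scale q l) @ F --> 0.
Proof.
move=> pq ua.
have ratio0 : (fun l => root_scale p l / root_scale q l) @ F --> 0.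
  apply: (squeeze_cvgr _ (cvg_cst (0 : R)) (root_scale_cvg0 p.+1)).
  near=> l.
  have l1 : `|l| <= 1 by near: l; exact: near_norm_le1.
  have q0 : 0 < root_scale q l by near: l; exact: near_root_scale_gt0.
  rewrite divr_ge0 ?root_scale_ge0 // andTb ler_pdivrMr // -(root_scaleS p) expr2.
  by rewrite ler_wpM2l ?root_scale_ge0 // root_scale_le.
have FF' : Filter F by typeclasses eauto.
have lim := cvgM (FF := FF') ua ratio0.
rewrite mulr0 in lim; apply: (cvg_near_eq lim); near=> l => /=.
rewrite mulrA divfK // gt_eqF //.
by near: l; exact: near_root_scale_gt0.
Unshelve. all: by end_near. Qed.

End RootScale.

(** * Leading coefficients of a branch along an ultrafilter *)

Section Branch.
Variables (R : realType) (k : nat) (f : 'rV[R]_(1 + k + 1) -> R) (m : nat).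
Hypotheses (Vf : VN0 f) (good_f : good_jets m (jet2 f)).
Variable i0 : 'I_k.

Let h := pderiv (ix_self k) (pderiv (ix_self k) f) 0 / 2.
Let v := pderiv (ix_par k) (pderiv (ix_self k) f) 0.
Let val q := @tree_val k R (f_edge f) v q.

Lemma good_self : h != 0.
Proof.
by case: good_f => + _; rewrite mxE /h => h0; rewrite mulf_neq0 // invr_eq0 pnatr_eq0.
Qed.

Lemma good_node_sum q (nd : node_of k (tree k q)) : (q <= m)%N ->
  node_sum (@val q) (f_edge f) nd != 0.
Proof.
case: good_f => _ nr qm; have := nr q qm nd.
rewrite (_ : (fun i => (jet2 f).1 0 (ix_edge i)) = f_edge f); last first.
  by apply/funext => i; rewrite mxE.
by rewrite (_ : (jet2 f).2 (ix_par k) (ix_self k) = v) // mxE.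
Qed.

(** This is the sum at the node of depth 0 whose inputs all have coefficient [v]; it makes both
    factors nonzero. *)
Lemma good_edge_sum : (\sum_i f_edge f i) * v != 0.
Proof.
have := @good_node_sum 0 (i0, false, [ffun=> Some false]) (leq0n m).
rewrite /node_sum /node_input /=; apply: contraNN => /eqP e; apply/eqP.
rewrite -[RHS]e mulr_suml; apply: eq_bigr => i _.
by rewrite ffunE; case: ifP; rewrite /= /val /= mul1r.
Qed.

Lemma good_par : v != 0.
Proof. by have := good_edge_sum; rewrite mulf_eq0 negb_or => /andP[]. Qed.

Variable F : set_system R.
Hypotheses (UF : UltraFilter F) (F0 : F --> (0 : R)).
Hypothesis ln0 : \forall l \near F, l != 0.
Variables (L : network k) (n : nat) (lay : L -> nat) (b : R -> {ffun L -> R}).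
Hypothesis ffL : feed_forward n lay.
Hypothesis b0 : forall c, (fun l => b l c) @ F --> 0.
Hypothesis fb : forall c : L, \forall l \near F,
  f (arg_point (b l c) (\row_i b l (src i c)) l) = 0.

Let FF : ProperFilter F. Proof. typeclasses eauto. Qed.

Let zero_at (c : L) := \forall l \near F, b l c = 0.
Let scaled_cvg q (c : L) (a : R) := (fun l => h * b l c / root_scale q l) @ F --> a.

Lemma zero_at_scaled_cvg q c : zero_at c -> scaled_cvg q c 0.
Proof.
move=> z; apply: (cvg_near_eq (cvg_cst (0 : R))).
by apply: filterS z => l ->; rewrite mulr0 mul0r.
Qed.

(** The ultrafilter lies on one side of 0, and [(-1) ^+ s] is the sign of the parameter there. *)
Lemma sign_cvg : exists s : bool,
  (fun l => l / root_scale 0 l) @ F --> ((-1) ^+ s : R) /\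
  forall u (a : R), (fun l => u l / l) @ F --> a ->
    (fun l => u l / root_scale 0 l) @ F --> (-1) ^+ s * a.
Proof.
have [s s0] : exists s : bool, \forall l \near F, `|l| = (-1) ^+ s * l.
  have [l0|l0] := in_ultra_setVsetC [set l : R | 0 <= l] UF.
    by exists false; apply: filterS l0 => l ?; rewrite mul1r ger0_norm.
  exists true; apply: filterS l0 => l /negP; rewrite -ltNge => ?.
  by rewrite mulN1r ltr0_norm.
have ss : (-1) ^+ s * (-1) ^+ s = 1 :> R by rewrite -expr2 sqrr_sign.
exists s; split=> [|u a ua].
  apply: (cvg_near_eq (cvg_cst ((-1) ^+ s : R))).
  near=> l; have l0 : l != 0 by near: l.
  rewrite /root_scale /= (_ : `|l| = (-1) ^+ s * l); last by near: l.
  by rewrite invfM mulrCA divff // mulr1 invr_sign.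
apply: (cvg_near_eq (cvgMl_tmp (FF := _) (a := (-1) ^+ s) ua)).
near=> l; have l0 : l != 0 by near: l.
rewrite /root_scale /= (_ : `|l| = (-1) ^+ s * l); last by near: l.
by rewrite invfM invr_sign; ring.
Unshelve. all: by end_near. Qed.

Definition node_inputs q c (nd : node_of k (tree k q)) : Prop :=
  forall i, scaled_cvg q (src i c) (oapp (@val q) 0 (node_input nd i)).

Lemma cell_trivial_inputs c : (forall i, zero_at (src i c)) ->
  zero_at c \/ (fun l => h * b l c / l) @ F --> - v.
Proof.
move=> z; have [?|nz] := in_ultra_setVsetC [set l | b l c = 0] UF; [by left|right].
apply: (@branch_trivial_inputs _ _ _ Vf _ _ F0 good_self (fun l => b l c)
  (fun i l => b l (src i c))) => //.
by apply: filterS nz => l /eqP.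
Qed.

(** The inequality, from which all sign conditions come, holds because the quotients of the first
    limit are nonnegative. *)
Lemma cell_square_ge0 q c (eta : 'I_k -> R) :
  (forall i, scaled_cvg q (src i c) (eta i)) ->
  (fun l => (h * b l c) ^+ 2 / root_scale q l) @ F --> - \sum_i f_edge f i * eta i /\
  \sum_i f_edge f i * eta i <= 0.
Proof.
move=> yeta.
have lim : (fun l => (h * b l c) ^+ 2 / root_scale q l) @ F -->
    - \sum_i f_edge f i * eta i.
  exact: (branch_square_cvg Vf F0 good_self (b0 c) (fun i => b0 (src i c))
    (near_root_scale_gt0 ln0 q) (near_le_root_scale F0 q) (fb c) yeta).
split=> //; rewrite -oppr_ge0; apply: (cvgr_to_ge lim); apply: nearW => l.
by rewrite divr_ge0 ?sqr_ge0 // root_scale_ge0.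
Qed.

Lemma cell_node_cvg q c (nd : node_of k (tree k q)) : node_inputs c nd ->
  exists s : bool, scaled_cvg q.+1 c (val ((nd, s) : tree k q.+1)).
Proof.
move=> ndP; have [lim E0] := cell_square_ge0 ndP.
rewrite -[\sum_i _]/(node_sum (@val q) (f_edge f) nd) in lim E0.
set E := node_sum _ _ _ in lim E0.
have [s us] : exists s : bool, scaled_cvg q.+1 c ((-1) ^+ s * Num.sqrt (- E)).
  apply: ultra_sqrt_cvg => //; apply: (cvg_near_eq lim); apply: nearW => l.
  by rewrite -root_scaleS expr_div_n.
by exists s; rewrite /val /= -/(val) ler0_norm.
Qed.

(** At the dominant scale [q] the inputs that are zero or of smaller order become [None], and an
    input of order exactly [q] fills the distinguished place. *)
Lemma cell_inputs c q :
  (forall i, zero_at (src i c) \/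
    exists p, (p <= q)%N /\ exists t : tree k p, scaled_cvg p (src i c) (val t)) ->
  (exists i (t : tree k q), scaled_cvg q (src i c) (val t)) ->
  exists nd : node_of k (tree k q), node_inputs c nd.
Proof.
move=> yi [i1 [t1 yt1]].
have /choice[g gP] : forall i, exists o : option (tree k q),
    scaled_cvg q (src i c) (oapp (@val q) 0 o).
  move=> i; have [z|[p [+ [t yt]]]] := yi i.
    by exists None; exact: zero_at_scaled_cvg.
  rewrite leq_eqVlt => /predU1P[pq|pq].
    by subst p; exists (Some t).
  exists None; exact: (root_scale_ratio_cvg0 F0 ln0 pq yt).
exists (i1, t1, [ffun i => g i]) => i.
by rewrite /node_input /= ffunE; case: eqP => [->|].
Qed.

Lemma cell_scaled_inputs c p :
  (forall i, zero_at (src i c) \/ exists q, (q < p)%N /\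
    exists t : tree k q, scaled_cvg q (src i c) (val t)) ->
  (forall i, zero_at (src i c)) \/
  exists q (nd : node_of k (tree k q)), (q < p)%N /\ node_inputs c nd.
Proof.
move=> yi; have [|/existsNP[i nz]] := pselect (forall i, zero_at (src i c)).
  by left.
right; have [//|[q1 [q1p yq1]]] := yi i.
(* The dominant scale is the largest [q] at which some input has a tree. *)
pose P q := `[< (q < p)%N /\ exists i (t : tree k q), scaled_cvg q (src i c) (val t) >].
have exP : exists q, P q by exists q1; apply/asboolP; split=> //; exists i.
have leP q : P q -> (q <= p)%N by move=> /asboolP[/ltnW].
case: (ex_maxnP exP leP) => q /asboolP[qp yq] maxq; exists q.
have [|nd ndP] := cell_inputs _ yq; last by exists nd.
move=> l; have [|[q' [q'p [t yt]]]] := yi l; [by left|right].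
exists q'; split; last by exists t.
by apply: maxq; apply/asboolP; split=> //; exists l, t.
Qed.

(** Induction over the layers: cells of layer 0 are their own inputs and vanish; a cell with zero
    inputs is zero or of scale 0; any other cell has the scale following that of its dominant
    inputs. *)
Lemma cell_scaled c : (lay c <= m.+1)%N -> zero_at c \/
  exists q, (q < lay c)%N /\ exists t : tree k q, scaled_cvg q c (val t).
Proof.
have [p] := ubnP (lay c); elim: p => // p IH in c *; rewrite ltnS => cp cm.
have [c0|cpos] := posnP (lay c).
  left; apply: (@branch_loop _ _ _ Vf _ _ F0 _ (fun i l => b l (src i c))) => //.
  - by move=> i; apply/funext => l; rewrite (ff_first ffL).
  - by have := good_edge_sum; rewrite mulf_eq0 negb_or => /andP[].
have srcE i : lay (src i c) = (lay c).-1 by rewrite -(ff_src ffL i cpos).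
have [|z|[q [nd [qc ndP]]]] := @cell_scaled_inputs c (lay c).-1.
- by move=> i; rewrite -(srcE i); apply: IH; rewrite srcE; lia.
- have [|lim] := cell_trivial_inputs z; [by left|right].
  have [s [_ /(_ _ _ lim) sl]] := sign_cvg.
  (* The limit is [(-1) ^+ s * - v]; negating the boolean absorbs the minus sign. *)
  exists 0%N; split=> //; exists (~~ s : tree k 0).
  have -> // : val (~~ s : tree k 0) = (-1) ^+ s * - v.
  by rewrite /val /=; case: s {sl} => /=; rewrite !(mulN1r, mul1r, opprK).
- right; exists q.+1; split; first by lia.
  by have [s sc] := cell_node_cvg ndP; exists (nd, s).
Qed.

(** Both cells solve the same equation, so their coefficients come from the same two candidates.
    Equal nonzero coefficients are excluded by [branch_separation], and both cells being zero by the
    last hypothesis. *)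
Lemma split_limits c1 c2 : (forall i, src i c1 = src i c2) -> (0 < lay c1)%N ->
  (lay c1 <= m.+1)%N -> (\forall l \near F, b l c1 != b l c2) ->
  exists q a1 a2, [/\ scaled_cvg q c1 a1, scaled_cvg q c2 a2 & exists2 a, a != 0 &
    [\/ a1 = 0 /\ a2 = a, a1 = a /\ a2 = 0 | a1 = a /\ a2 = - a]].
Proof.
move=> s12 cpos cm ne.
have contra : (\forall l \near F, b l c1 = b l c2) -> False.
  by move=> e; have [l [/eqP]] := filter_ex (filterI ne e).
have srcE i : lay (src i c1) = (lay c1).-1 by rewrite -(ff_src ffL i cpos).
have fb2 : \forall l \near F, f (arg_point (b l c2) (\row_i b l (src i c1)) l) = 0.
  apply: filterS (fb c2) => l; suff -> : (\row_i b l (src i c1)) = \row_i b l (src i c2) by [].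
  by apply/rowP => i; rewrite !mxE s12.
have sep q a c : scaled_cvg q c1 a -> scaled_cvg q c2 a ->
    (forall i, (fun l => b l (src i c1) / root_scale q l) @ F --> 0) ->
    (fun l => l / root_scale q l) @ F --> c -> 2 * a + v * c != 0 -> False.
  move=> lim1 lim2 ylim clim ac; apply: contra.
  exact: (branch_separation Vf F0 good_self (b0 c1) (fun i => b0 (src i c1))
    (near_root_scale_gt0 ln0 q) (b0 c2) (fb c1) fb2 lim1 lim2 ylim clim ac).
have [|z|[q [nd [qc ndP]]]] := @cell_scaled_inputs c1 (lay c1).-1.
- by move=> i; rewrite -(srcE i); apply: cell_scaled; rewrite srcE; lia.
- have z2 i : zero_at (src i c2) by rewrite -s12.
  have [s [s1 sl]] := sign_cvg; pose a := (-1) ^+ s * - v.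
  have sv : (-1) ^+ s * v != 0 by rewrite mulf_neq0 ?signr_eq0 ?good_par.
  have a0 : a != 0 by rewrite /a mulrN oppr_eq0.
  have [z1|/sl l1] := cell_trivial_inputs z; have [z1'|/sl l2] := cell_trivial_inputs z2.
  + by case: contra; apply: filterS2 z1 z1' => l -> ->.
  + exists 0%N, 0, a; split=> //; first exact: zero_at_scaled_cvg.
    by exists a => //; constructor 1.
  + exists 0%N, a, 0; split=> //; first exact: zero_at_scaled_cvg.
    by exists a => //; constructor 2.
  (* Here the parameter has coefficient [c = (-1) ^+ s], so [2 * a + v * c] is [a] itself. *)
  + case: (sep 0%N a _ l1 l2 _ s1).
      move=> i; apply: (cvg_near_eq (cvg_cst (0 : R))).
      by apply: filterS (z i) => l ->; rewrite mul0r.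
    by rewrite (_ : _ + _ = a) // /a; ring.
- have [s1 lim1] := cell_node_cvg ndP.
  have [|s2 lim2] := @cell_node_cvg q c2 nd; first by move=> i; rewrite -s12; exact: ndP.
  set a := val _ in lim1.
  have a0 : a != 0.
    rewrite /a /val /= mulf_neq0 ?signr_eq0 // sqrtr_eq0 -ltNge normr_gt0.
    by apply: good_node_sum; lia.
  have [s12E|s12E] := eqVneq s1 s2; last first.
    exists q.+1, a, (- a); split=> //.
      rewrite (_ : - a = val ((nd, s2) : tree k q.+1)) // /a /val /=.
      by case: s1 s2 s12E {lim1 lim2 a a0} => [] [] //= _; rewrite !(mulN1r, mul1r, opprK).
    by exists a => //; constructor 3.
  rewrite -s12E -/a in lim2.
  (* At scale [q.+1] the inputs and the parameter are negligible, so only [2 * a] has to be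
     nonzero. *)
  case: (sep q.+1 a 0 lim1 lim2).
  + move=> i; apply: (@root_scale_ratio_cvg0 _ _ _ F0 ln0 q _ _
      (oapp (@val q) 0 (node_input nd i) / h)) => //.
    apply: (cvg_near_eq (cvgMr_tmp (FF := _) (b := h^-1) (ndP i))).
    by near=> l; field; rewrite good_self /= gt_eqF //; near: l; exact: near_root_scale_gt0.
  + by have [s [sl _]] := sign_cvg; exact: (root_scale_ratio_cvg0 F0 ln0 _ sl).
  + by rewrite mulr0 addr0 mulf_neq0 // pnatr_eq0.
Unshelve. all: by end_near. Qed.

(** This is the inequality of [cell_square_ge0] for [d], with the sum grouped by the source of each
    edge. *)
Lemma weight_nonpos q c1 c2 a1 a2 d : scaled_cvg q c1 a1 -> scaled_cvg q c2 a2 ->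
  c1 != c2 -> (forall i, src i d \in [set c1; c2]%SET) ->
  weight f c1 d * a1 + weight f c2 d * a2 <= 0.
Proof.
move=> l1 l2 c12 sd.
have [|_] := @cell_square_ge0 q d (fun i => if src i d == c1 then a1 else a2).
  move=> i; have := sd i; rewrite !inE; case: eqP => [-> //|_ /eqP-> //].
congr (_ <= _).
rewrite /weight [X in _ = X * a1 + _]big_mkcond [X in _ = _ + X * a2]big_mkcond /=.
rewrite !mulr_suml -big_split /=; apply: eq_bigr => i _; have := sd i; rewrite !inE.
case: eqP => [->|_ /eqP->]; rewrite ?eqxx ?(negPf c12) ?mul0r ?addr0 //.
by rewrite add0r.
Qed.

Lemma split_synchronous c1 c2 : c1 != c2 -> (forall i, src i c1 = src i c2) ->
  (0 < lay c1 <= m.+1)%N ->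
  (exists d1 d2 : L, [/\ forall i, src i d1 \in [set c1; c2]%SET,
      forall i, src i d2 \in [set c1; c2]%SET,
      weight f c1 d1 * weight f c1 d2 < 0, weight f c2 d1 * weight f c2 d2 < 0 &
      weight f c1 d1 * weight f c1 d2 + weight f c2 d1 * weight f c2 d2 <
      weight f c1 d1 * weight f c2 d2 + weight f c1 d2 * weight f c2 d1]) ->
  ~ \forall l \near F, b l c1 != b l c2.
Proof.
move=> c12 s12 /andP[cpos cm] [d1 [d2 [sd1 sd2 w1 w2 w3]]] /(split_limits s12 cpos cm).
move=> [q [a1 [a2 [l1 l2 [a a0]]]]].
have := weight_nonpos l1 l2 c12 sd1; have := weight_nonpos l1 l2 c12 sd2.
move: w1 w2 w3; move: (weight f c1 d1) (weight f c1 d2) => x1 x2.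
move: (weight f c2 d1) (weight f c2 d2) => y1 y2 w1 w2 w3 h2 h1.
have aa : 0 < a ^+ 2 by rewrite exprn_even_gt0.
have prod u w : u * a <= 0 -> w * a <= 0 -> 0 <= u * w.
  move=> ua wa; rewrite -(pmulr_lge0 _ aa) (_ : u * w * a ^+ 2 = (u * a) * (w * a)); last by ring.
  exact: mulr_le0.
case=> -[e1 e2]; rewrite e1 e2 ?mulr0 ?add0r ?addr0 in h1 h2.
- by have := prod _ _ h1 h2; rewrite leNgt w2.
- by have := prod _ _ h1 h2; rewrite leNgt w1.
(* For [(a, - a)] the inequalities give [(x1 - y1) * (x2 - y2) >= 0], contrary to [w3]. *)
- rewrite !mulrN -!mulrBl in h1 h2.
  by have := prod _ _ h1 h2; lra.
Qed.

End Branch.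

(** * Synchrony of the split cells near the origin *)

Lemma branch_cvg0 (R : realType) (k : nat) (L : network k) (b : pfun R L) c :
  branch_regular b -> (fun l => b l c) @ within (dom b) (nbhs (0 : R)) --> b 0 c.
Proof.
move=> [l0 l0_gt0 [[D sm]|[D sm]]].
  have b0 : dom b 0 by rewrite D /= in_itv /= oppr_lt0 l0_gt0.
  have /derivable1_diffP/differentiable_continuous := sm c 0%N 0 b0.
  exact: cvg_within_filter.
have b0 : dom b 0 by case: D => -> /=; rewrite in_itv /= ?oppr_lt0 l0_gt0 ?lexx.
by have [/subspace_continuousP/(_ _ b0)] := sm c.
Qed.

(** By balance the sources are equal or both in the split, and the latter is impossible because
    sources lie one layer lower. *)
Lemma split_src (k : nat) (L : network k) n (lay : L -> nat) (c1 c2 : L) :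
  feed_forward n lay -> (0 < lay c1)%N -> lay c1 = lay c2 ->
  balanced (collapse [set c1; c2]%SET) -> forall i, src i c1 = src i c2.
Proof.
move=> ffL l0 l12 bal i.
have := bal c1 c2 _ i; rewrite /= /collapse_rel !inE !eqxx !orbT.
case/(_ isT)/orP => [/eqP //|/andP[+ _]]; have := ff_src ffL i l0.
by move=> + /orP[] /eqP e; rewrite e; lia.
Qed.

Theorem proposition6p7 (R : realType) (k : nat) (N : network k) (m : nat)
    (layN : N -> nat) (ffN : feed_forward m layN) :
  generically (@VN0 R k) (fun f =>
    forall (L : network k) (n : nat) (layL : L -> nat),
    feed_forward n layL ->
    lift_of L N ->
    forall j : nat, (1 < j <= m - 1)%N ->
    forall (c : N) (c1 c2 : L)
      (phi : quotient_network (collapse [set c1; c2]%SET) -> N),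
    layN c = j -> layL c1 = j -> layL c2 = j -> c1 != c2 ->
    split_of c phi ->
    (exists d' d'' : L,
      [/\ layN (phi (class_of (collapse [set c1; c2]%SET) d')) = j.+1,
          layN (phi (class_of (collapse [set c1; c2]%SET) d'')) = j.+1,
          forall i : 'I_k, src i d' \in [set c1; c2]%SET /\
                           src i d'' \in [set c1; c2]%SET &
          [/\ weight f c1 d' * weight f c1 d'' < 0,
              weight f c2 d' * weight f c2 d'' < 0 &
              weight f c1 d' * weight f c1 d'' +
              weight f c2 d' * weight f c2 d'' <
              weight f c1 d' * weight f c2 d'' +
              weight f c1 d'' * weight f c2 d']]) ->
    forall b : pfun R L, bifurcation_branch f b -> lifted_from N b).
Proof.
exists (@jet2 R (1 + k + 1) @` @VN0 R k `&` good_jets m).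
  exact: generic_good_jets.
move=> f Vf [_ good_f] L n lay ffL _ j /andP[j1 jm] c c1 c2 phi _ l1 l2 c12.
move=> [_ bal iso _] [d1 [d2 [_ _ sd [w1 w2 w3]]]] b [[reg b0 fb] _].
exists (collapse [set c1; c2]%SET); split=> //; first by exists phi.
suff sync : \forall l \near (0 : R), dom b l -> b l c1 = b l c2.
  apply: filterS sync => l sync /sync e x y /= /orP[/eqP->//|].
  by rewrite !inE => /andP[/orP[] /eqP-> /orP[] /eqP->].
apply: contrapT => nsync.
(* If synchrony fails, [D] meets every neighborhood of 0, so their traces on [D] form a proper
   filter, which some ultrafilter refines. *)
pose D := [set l | dom b l /\ b l c1 != b l c2].
have PF : ProperFilter (within D (nbhs (0 : R))).
  apply: Build_ProperFilter; rewrite /within /= => D0; apply: nsync.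
  apply: filterS D0 => l Dl dl; apply: contrapT => /eqP ne.
  exact: Dl.
have [U [UU DU]] := ultraFilterLemma PF.
have nearD : \forall l \near U, dom b l /\ b l c1 != b l c2.
  by apply: DU; apply: withinT; exact: nbhs_filter.
have U0 : U --> (0 : R) by move=> P P0; apply: DU; apply: filterS P0 => l Pl _.
(* Without edge types every weight would be 0, contrary to [w1]. *)
have [i0 _] : exists i : 'I_k, True.
  case: (pickP (fun _ : 'I_k => true)) => [i _|none]; first by exists i.
  by move: w1; rewrite /weight !big_pred0 ?mulr0 ?ltxx // => i; have := none i.
have s12 : forall i, src i c1 = src i c2.
  by apply: (split_src ffL _ _ bal); rewrite l1 ?l2 // ltnW.
have bU c' : (fun l => b l c') @ U --> (0 : R).
  have := @branch_cvg0 _ _ _ _ c' reg; rewrite b0 ffunE; apply: cvg_trans => P.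
  move=> bP; have {}bP : \forall l \near (0 : R), dom b l -> P (b l c') by exact: bP.
  by apply: DU; apply: filterS bP => l + [dl _]; apply.
apply: (@split_synchronous R k f m Vf good_f i0 U UU U0 _ L n lay b ffL bU _
  c1 c2 c12 s12) => //.
(* The parameter is nonzero along [U], since at 0 the branch vanishes and the two cells agree. *)
- apply: filterS nearD => l [_]; apply: contraNneq => ->.
  by rewrite b0 !ffunE.
- move=> c'; apply: filterS nearD => l [dl _].
  by have := fb l dl => /ffunP/(_ c'); rewrite !ffunE.
- by rewrite l1; apply/andP; split; lia.
- by exists d1, d2; split=> // i; case: (sd i).
- by apply: filterS nearD => l [].
Qed.
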